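(* Let $G\in\mathcal{P}$, i.e. $G$ is a finite product of groups of the form $SU(r)$, $U(q)$, $Sp(k)$. Let $\pi$ be a finitely generated abelian group written as $\pi=\mathbb{Z}/(q_1)\oplus\cdots\oplus\mathbb{Z}/(q_n)$, where $n\ge 0$ and $q_1,\dots,q_n$ are integers (some of which may be $0$, with $\mathbb{Z}/(0)=\mathbb{Z}$). Then there is a $G$-equivariant homotopy equivalence \[ \Theta:\Sigma \operatorname{Hom}(\pi,G)\to \bigvee_{1\le r\le n}\Sigma\left(\bigvee_{\mathfrak{m}\in J_{n,r}}\operatorname{Hom}(P_{\mathfrak{m}}(\pi),G)/S_{1}(P_{\mathfrak{m}}(\pi),G)\right). \]
   Context: $\operatorname{Hom}(\pi,G)$ is identified, via the standard generators of the summands $\mathbb{Z}/(q_i)$, with the subspace of $G^n$ (with the subspace topology) of commuting $n$-tuples $(x_1,\dots,x_n)$ such that $x_i^{q_i}=1_G$ for all $i$. $G$ acts on it by (simultaneous) conjugation. For $1\le r\le n$, $J_{n,r}$ is the set of all sequences $\mathfrak{m}=\{1\le m_1<\cdots<m_r\le n\}$ of integers. For such $\mathfrak{m}$, $P_{\mathfrak{m}}(\pi):=\mathbb{Z}/(q_{m_1})\oplus\cdots\oplus\mathbb{Z}/(q_{m_r})$, a quotient of $\pi$. $S_1(P_{\mathfrak{m}}(\pi),G)\subset \operatorname{Hom}(P_{\mathfrak{m}}(\pi),G)$ is the subspace of those $r$-tuples $(x_{m_1},\dots,x_{m_r})$ in $\operatorname{Hom}(P_{\mathfrak{m}}(\pi),G)\subset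 G^r$ for which at least one $x_{m_i}$ equals $1_G$; it is invariant under conjugation, so the quotient is a based $G$-space. $\Sigma$ denotes the (reduced) suspension with $G$ acting trivially on the suspension coordinate; $\operatorname{Hom}(\pi,G)$ is based at the trivial homomorphism $(1_G,\dots,1_G)$. *)

(* Defs.v *)
From HB Require Import structures.
From mathcomp Require Import all_boot all_order all_algebra.
From mathcomp Require Import generic_quotient complex spectral.
From mathcomp Require Import all_classical all_reals all_analysis homotopy.

Set Implicit Arguments.
Unset Strict Implicit.
Unset Printing Implicit Defensive.

Import Order.TTheory GRing.Theory Num.Theory.
Import numFieldTopology.Exports numFieldNormedType.Exports.

Local Open Scope classical_set_scope.
Local Open Scope ring_scope.
Local Open Scope quotient_scope.

HB.mixin Record isTopGroup G & Group G & Topological G := {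
  mulg_continuous : continuous (fun x : G * G => (x.1 * x.2)%g);
  invg_continuous : continuous (fun x : G => x^-1%g)
}.

#[short(type="topGroupType")]
HB.structure Definition TopGroup :=
  {G of isTopGroup G & Group G & Topological G}.

Section continuity_tools.

Lemma continuous_mx (T Z : topologicalType) m n (f : Z -> 'M[T]_(m, n)) :
  (forall i j, continuous (fun z => f z i j)) -> continuous f.
Proof.
move=> cf z A [P Pz PA].
have H :
    \forall w \near z, forall ij : 'I_m * 'I_n, P ij.1 ij.2 (f w ij.1 ij.2).
  by apply: filter_forall => -[i j] /=; exact: (cf i j z _ (Pz i j)).
by apply: filterS H => w Pw; apply: PA => i j; exact: Pw (i, j).
Qed.

Lemma mx_entry_continuous (T : topologicalType) m n (i : 'I_m) (j : 'I_n) :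
  continuous (fun M : 'M[T]_(m, n) => M i j).
Proof.
move=> M A MA; exists (fun k l => [set x | k = i -> l = j -> A x]).
  move=> k l; have [/= [-> ->]|ne] := eqVneq (k, l) (i, j).
    by apply: filterS MA => x Ax.
  apply: filterE => x /= ki lj.
  by move: ne; rewrite ki lj eqxx.
by move=> N /(_ i j) /= /(_ erefl erefl).
Qed.

Lemma continuous_set_type (X Z : topologicalType) (A : set X) (f : Z -> A) :
  continuous (fun z => \val (f z)) -> continuous f.
Proof. by move=> cf; exact: continuous_comp_initial. Qed.

Lemma continuous_val (X : topologicalType) (A : set X) :
  continuous (fun x : A => \val x).
Proof. by have := @initial_continuous A X set_val. Qed.

Lemma continuous_ptws (I : Type) (T : I -> topologicalType)
    (Z : topologicalType) (f : Z -> prod_topology T) :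
  (forall i, continuous (fun z => f z i)) -> continuous f.
Proof.
move=> cf z; apply/cvg_sup => i.
have h := @continuous_comp_initial _ _ _ (fun h : forall i, T i => h i) f.
exact: h (cf i) z.
Qed.

Lemma continuous_pair (Z X Y : topologicalType) (f : Z -> X) (g : Z -> Y) :
  continuous f -> continuous g -> continuous (fun z => (f z, g z)).
Proof. by move=> cf cg z; apply: cvg_pair; [exact: cf|exact: cg]. Qed.

Lemma continuous_mulg (G : topGroupType) (Z : topologicalType) (f h : Z -> G) :
  continuous f -> continuous h -> continuous (fun z => (f z * h z)%g).
Proof.
move=> cf ch z; apply: (@continuous_comp _ _ _ (fun z => (f z, h z))
  (fun x : G * G => (x.1 * x.2)%g)); last exact: mulg_continuous.
exact: continuous_pair.
Qed.

Lemma continuous_invg (G : topGroupType) (Z : topologicalType) (f : Z -> G) :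
  continuous f -> continuous (fun z => (f z)^-1%g).
Proof.
move=> cf z; apply: (@continuous_comp _ _ _ f (fun x : G => x^-1%g)).
  exact: cf.
exact: invg_continuous.
Qed.

End continuity_tools.

Definition Cplx (R : realType) : numClosedFieldType := R[i]%C.

Lemma conj_continuous (R : realType) :
  continuous (Num.conj : Cplx R -> Cplx R).
Proof.
move=> z A [e e0 eA]; exists e => // w zw; apply: eA.
by rewrite /= -rmorphB norm_conjC.
Qed.

Inductive classical_group :=
  | SpecialUnitary of nat
  | Unitary of nat
  | Symplectic of nat.

Definition cg_dim (c : classical_group) : nat :=
  match c with
  | SpecialUnitary r => r
  | Unitary r => r
  | Symplectic k => k + k
  end.

Definition symplectic_form (R : realType) (k : nat) : 'M[Cplx R]_(k + k) :=
  block_mx 0 1%:M (- 1%:M) 0.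

(* Sp(k) is the compact symplectic group, i.e., the unitary group of the
   quaternionic space H^k; under H^k = C^(2k), it consists of the unitary
   matrices of size 2k that preserve the standard symplectic form. *)
Definition cg_set (R : realType) (c : classical_group) :
    set 'M[Cplx R]_(cg_dim c) :=
  match c return set 'M[Cplx R]_(cg_dim c) with
  | SpecialUnitary r => [set A | A \is unitarymx /\ \det A = 1]
  | Unitary r => [set A | A \is unitarymx]
  | Symplectic k => [set A | A \is unitarymx /\
      A^T *m symplectic_form R k *m A = symplectic_form R k]
  end.

Arguments cg_set : clear implicits.

Section classical_group_theory.
Local Open Scope sesquilinear_scope.
Variables (R : realType) (c : classical_group).

Lemma cg_unitary A : cg_set R c A -> A \is unitarymx.
Proof. by case: c A => [r|r|k] A //= []. Qed.

Lemma cg_set1 : cg_set R c 1%:M.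
Proof.
have u1 n : (1%:M : 'M[Cplx R]_n) \is unitarymx.
  by apply/unitarymxP; rewrite mul1mx trmx1 map_mx1.
case: c => [r|r|k] /=; last 1 first.
- by split; rewrite ?trmx1 ?mul1mx ?mulmx1.
- by split; rewrite ?det1.
- exact: u1.
Qed.

Lemma cg_setM A B : cg_set R c A -> cg_set R c B -> cg_set R c (A *m B).
Proof.
case: c A B => [r|r|k] A B /=.
- move=> [uA dA] [uB dB]; split; first exact: mul_unitarymx.
  by rewrite det_mulmx dA dB mulr1.
- exact: mul_unitarymx.
- move=> [uA sA] [uB sB]; split; first exact: mul_unitarymx.
  by rewrite trmx_mul -!mulmxA (mulmxA A^T) (mulmxA _ A) sA mulmxA.
Qed.

Lemma cg_setV A : cg_set R c A -> cg_set R c (A^t*).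
Proof.
case: c A => [r|r|k] A /=.
- move=> [uA dA]; split; first by rewrite trmxC_unitary.
  by rewrite det_map_mx det_tr dA rmorph1.
- by rewrite trmxC_unitary.
- move=> [uA sA]; split; first by rewrite trmxC_unitary.
  have /unitarymxP AV := uA; have VA := mulmx1C AV.
  have VAT : (A^t*)^T *m A^T = 1%:M by rewrite -trmx_mul AV trmx1.
  by rewrite -[in LHS]sA !mulmxA VAT mul1mx -mulmxA AV mulmx1.
Qed.

Definition cg : Type := set_type (cg_set R c).

HB.instance Definition _ := Topological.on cg.

Let inG A (h : cg_set R c A) : cg := exist _ A (mem_set h).
Let mul (A B : cg) : cg := inG (cg_setM (set_valP A) (set_valP B)).
Let one : cg := inG cg_set1.
Let inv (A : cg) : cg := inG (cg_setV (set_valP A)).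

Fact cg_mulA : associative mul.
Proof. by move=> A B D; apply/val_inj; rewrite /= mulmxA. Qed.
Fact cg_mul1 : left_id one mul.
Proof. by move=> A; apply/val_inj; rewrite /= mul1mx. Qed.
Fact cg_1mul : right_id one mul.
Proof. by move=> A; apply/val_inj; rewrite /= mulmx1. Qed.
Fact cg_mulV : right_inverse one inv mul.
Proof.
move=> A; apply/val_inj => /=.
by apply/unitarymxP; exact: cg_unitary (set_valP A).
Qed.
Fact cg_Vmul : left_inverse one inv mul.
Proof.
move=> A; apply/val_inj => /=; apply: mulmx1C.
by have /(congr1 val) := cg_mulV A.
Qed.

HB.instance Definition _ :=
  isGroup.Build cg cg_mulA cg_mul1 cg_1mul cg_Vmul cg_mulV.

Fact cg_entry_continuous i j : continuous (fun x : cg => \val x i j).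
Proof.
move=> x; apply: (@continuous_comp _ _ _ (fun x : cg => \val x)
  (fun M : 'M[Cplx R]_(cg_dim c) => M i j)); first exact: continuous_val.
exact: mx_entry_continuous.
Qed.

Fact cg_mulg_continuous : continuous (fun x : cg * cg => (x.1 * x.2)%g).
Proof.
apply: continuous_set_type; apply: continuous_mx => i j.
have -> : (fun z : cg * cg => \val (z.1 * z.2)%g i j) =
   (fun z : cg * cg => \sum_k (\val z.1 i k * \val z.2 k j)).
  by apply/funext => z; rewrite /= mxE.
move=> z; apply: cvg_big => [|k _]; first exact: add_continuous.
apply: cvgM.
- apply: (@continuous_comp _ _ _ fst (fun x : cg => \val x i k));
    last exact: cg_entry_continuous.
  exact: cvg_fst.
- apply: (@continuous_comp _ _ _ snd (fun x : cg => \val x k j));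
    last exact: cg_entry_continuous.
  exact: cvg_snd.
Qed.

Fact cg_invg_continuous : continuous (fun x : cg => x^-1%g).
Proof.
apply: continuous_set_type; apply: continuous_mx => i j.
have -> : (fun z : cg => \val (z^-1)%g i j) = (fun z : cg => (\val z j i)^*).
  by apply/funext => z; rewrite /= !mxE.
move=> z; apply: (@continuous_comp _ _ _ (fun x : cg => \val x j i) Num.conj).
  exact: cg_entry_continuous.
exact: conj_continuous.
Qed.

HB.instance Definition _ :=
  isTopGroup.Build cg cg_mulg_continuous cg_invg_continuous.

End classical_group_theory.

Section product_group.
Variables (R : realType) (k : nat) (c : 'I_k -> classical_group).

Definition cg_prod : Type := prod_topology (fun i => cg R (c i)).

HB.instance Definition _ := Topological.on cg_prod.

Let mul (x y : cg_prod) : cg_prod := fun i => (x i * y i)%g.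
Let one : cg_prod := fun i => 1%g.
Let inv (x : cg_prod) : cg_prod := fun i => ((x i)^-1)%g.

Fact cg_prod_mulA : associative mul.
Proof. by move=> x y z; apply/functional_extensionality_dep => i; exact: mulgA. Qed.
Fact cg_prod_mul1 : left_id one mul.
Proof. by move=> x; apply/functional_extensionality_dep => i; exact: mul1g. Qed.
Fact cg_prod_1mul : right_id one mul.
Proof. by move=> x; apply/functional_extensionality_dep => i; exact: mulg1. Qed.
Fact cg_prod_mulV : right_inverse one inv mul.
Proof. by move=> x; apply/functional_extensionality_dep => i; exact: mulgV. Qed.
Fact cg_prod_Vmul : left_inverse one inv mul.
Proof. by move=> x; apply/functional_extensionality_dep => i; exact: mulVg. Qed.

HB.instance Definition _ := isGroup.Build cg_prod
  cg_prod_mulA cg_prod_mul1 cg_prod_1mul cg_prod_Vmul cg_prod_mulV.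

Let coord_continuous i : continuous (fun x : cg_prod => x i).
Proof. exact: (@proj_continuous _ (fun i => cg R (c i))). Qed.

Fact cg_prod_mulg_continuous :
  continuous (fun x : cg_prod * cg_prod => (x.1 * x.2)%g).
Proof.
apply: (@continuous_ptws _ (fun i => cg R (c i))) => i z.
apply: continuous_mulg => {}z.
- apply: (@continuous_comp _ _ _ fst (fun x : cg_prod => x i));
    first exact: cvg_fst.
  exact: coord_continuous.
- apply: (@continuous_comp _ _ _ snd (fun x : cg_prod => x i));
    first exact: cvg_snd.
  exact: coord_continuous.
Qed.

Fact cg_prod_invg_continuous : continuous (fun x : cg_prod => x^-1%g).
Proof.
apply: (@continuous_ptws _ (fun i => cg R (c i))) => i z.
exact/continuous_invg/coord_continuous.
Qed.

HB.instance Definition _ :=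
  isTopGroup.Build cg_prod cg_prod_mulg_continuous cg_prod_invg_continuous.

End product_group.

(* Joint continuity of the action G x X -> X is not recorded: equivariance of
   maps and of homotopies does not depend on it. *)
Record bgspace (G : topGroupType) := BGSpace {
  bg_space :> topologicalType;
  bg_pt : bg_space;
  bg_act : G -> bg_space -> bg_space;
  bg_act1 : forall x, bg_act 1%g x = x;
  bg_actM : forall g h x, bg_act (g * h)%g x = bg_act g (bg_act h x);
  bg_act_pt : forall g, bg_act g bg_pt = bg_pt;
  bg_act_continuous : forall g, continuous (bg_act g)
}.
Arguments bg_pt {G} b.
Arguments bg_act {G} b.

Definition unit_itv (R : realType) : Type := set_type `[0 : R, 1]%classic.
HB.instance Definition _ (R : realType) := Topological.on (unit_itv R).

Section maps.
Variables (R : realType) (G : topGroupType).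

Record bgmap (X Y : bgspace G) (f : X -> Y) : Prop := {
  bgmap_continuous : continuous f;
  bgmap_equivariant : forall g x, f (bg_act X g x) = bg_act Y g (f x);
  bgmap_pt : f (bg_pt X) = bg_pt Y
}.

Definition bghomotopic (X Y : bgspace G) (f0 f1 : X -> Y) : Prop :=
  exists H : X * unit_itv R -> Y,
    [/\ continuous H,
        forall t, bgmap (fun x => H (x, t)),
        forall x t, \val t = 0 -> H (x, t) = f0 x
      & forall x t, \val t = 1 -> H (x, t) = f1 x].

Definition bg_homotopy_equivalence (X Y : bgspace G) (f : X -> Y) : Prop :=
  bgmap f /\ exists g : Y -> X,
    [/\ bgmap g, bghomotopic (g \o f) id & bghomotopic (f \o g) id].

End maps.

Section collapse.
Variables (X : topologicalType) (A : set X).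

Definition collapse_rel' (x y : X) := (x == y) || (x \in A) && (y \in A).

Fact collapse_refl : reflexive collapse_rel'.
Proof. by move=> x; rewrite /collapse_rel' eqxx. Qed.
Fact collapse_sym : symmetric collapse_rel'.
Proof. by move=> x y; rewrite /collapse_rel' eq_sym andbC. Qed.
Fact collapse_trans : transitive collapse_rel'.
Proof.
move=> y x z; rewrite /collapse_rel' => /predU1P[-> //|/andP[xA yA]].
by move=> /predU1P[<-|/andP[_ zA]]; rewrite xA ?yA ?zA orbT.
Qed.

Definition collapse_rel :=
  EquivRel collapse_rel' collapse_refl collapse_sym collapse_trans.

Definition collapse := {eq_quot collapse_rel}.

HB.instance Definition _ :=
  Topological.copy collapse (quotient_topology collapse).
HB.instance Definition _ := Quotient.on collapse.

Lemma collapse_eqP (x y : X) :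
  \pi_collapse x = \pi_collapse y <-> x = y \/ A x /\ A y.
Proof.
split=> [/eqmodP/predU1P[->|/andP[/set_mem Ax /set_mem Ay]]|h].
- by left.
- by right.
- apply/eqmodP/orP; case: h => [->|[Ax Ay]]; first by left; exact/eqP.
  by right; apply/andP; split; exact: mem_set.
Qed.

End collapse.

Section quotient_space.
Variables (G : topGroupType) (X : bgspace G) (A : set X).
Hypothesis A_act : forall g x, A x -> A (bg_act X g x).

Definition quotient_act g (x : collapse A) : collapse A :=
  \pi_(collapse A) (bg_act X g (repr x)).

Lemma quotient_actE g x :
  quotient_act g (\pi_(collapse A) x) = \pi_(collapse A) (bg_act X g x).
Proof.
rewrite /quotient_act; apply/collapse_eqP.
have : \pi_(collapse A) (repr (\pi_(collapse A) x)) = \pi_(collapse A) x.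
  by rewrite reprK.
by move=> /collapse_eqP[->|[Ax Ay]]; [left|right; split; exact: A_act].
Qed.

Fact quotient_act1 x : quotient_act 1%g x = x.
Proof. by elim/quotW: x => x; rewrite quotient_actE bg_act1. Qed.

Fact quotient_actM g h x :
  quotient_act (g * h)%g x = quotient_act g (quotient_act h x).
Proof.
by elim/quotW: x => x; rewrite (quotient_actE h) !quotient_actE bg_actM.
Qed.

Fact quotient_act_pt g :
  quotient_act g (\pi_(collapse A) (bg_pt X)) = \pi_(collapse A) (bg_pt X).
Proof. by rewrite quotient_actE bg_act_pt. Qed.

Fact quotient_act_continuous g : continuous (quotient_act g).
Proof.
apply/(@quotient_continuous _ (collapse A)).
have -> : quotient_act g \o \pi_(collapse A) = \pi_(collapse A) \o bg_act X g.
  by apply/funext => x /=; rewrite quotient_actE.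
move=> x; apply: continuous_comp; first exact: bg_act_continuous.
exact: pi_continuous.
Qed.

(* X / A, for an invariant subspace A; it is only used when A contains the
   base point of X, so that the base point of X / A is the class of A. *)
Definition quotient_space : bgspace G :=
  BGSpace quotient_act1 quotient_actM quotient_act_pt quotient_act_continuous.

End quotient_space.

Section suspension.
Variables (R : realType) (G : topGroupType) (X : bgspace G).

Fact unit_itv0_subproof : 0 \in `[0 : R, 1]%classic.
Proof. by rewrite inE /= in_itv /= lexx ler01. Qed.

Definition cylinder_act g (u : X * unit_itv R) : X * unit_itv R :=
  (bg_act X g u.1, u.2).
Definition cylinder_pt : X * unit_itv R :=
  (bg_pt X, exist _ 0 unit_itv0_subproof).

Fact cylinder_act1 u : cylinder_act 1%g u = u.
Proof. by case: u => x t; rewrite /cylinder_act bg_act1. Qed.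
Fact cylinder_actM g h u :
  cylinder_act (g * h)%g u = cylinder_act g (cylinder_act h u).
Proof. by rewrite /cylinder_act bg_actM. Qed.
Fact cylinder_act_pt g : cylinder_act g cylinder_pt = cylinder_pt.
Proof. by rewrite /cylinder_act bg_act_pt. Qed.
Fact cylinder_act_continuous g : continuous (cylinder_act g).
Proof.
apply: continuous_pair => u; last exact: cvg_snd.
apply: (@continuous_comp _ _ _ fst (bg_act X g)); first exact: cvg_fst.
exact: bg_act_continuous.
Qed.

Definition cylinder : bgspace G :=
  BGSpace cylinder_act1 cylinder_actM cylinder_act_pt cylinder_act_continuous.

Definition susp_collapsed : set cylinder :=
  [set u | [\/ \val u.2 = 0, \val u.2 = 1 | u.1 = bg_pt X]].

Fact susp_collapsed_act g u :
  susp_collapsed u -> susp_collapsed (bg_act cylinder g u).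
Proof.
move=> [u0|u1|upt]; [exact: Or31|exact: Or32|apply: Or33].
by rewrite /= upt bg_act_pt.
Qed.

Definition susp : bgspace G :=
  quotient_space susp_collapsed_act.

End suspension.

Section one_point.
Variable G : topGroupType.

Definition point_space : bgspace G :=
  @BGSpace G (discrete_topology unit) tt (fun _ x => x) (fun _ => erefl)
    (fun _ _ _ => erefl) (fun _ => erefl) (fun _ _ => cvg_id).

End one_point.

Section bigwedge.
Variables (G : topGroupType) (I : choiceType) (X : I -> bgspace G).

(* A one-point summand is added to the family, so that the wedge of the empty
   family is a point rather than the empty space. *)
Definition wedge_summand (o : option I) : bgspace G :=
  if o is Some i then X i else point_space G.

Definition bigwedge_type := wedge (fun o => bg_pt (wedge_summand o)).
Definition bigwedge_lift (o : option I) (x : wedge_summand o) : bigwedge_type :=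
  @wedge_lift _ wedge_summand (fun o => bg_pt (wedge_summand o)) o x.
Definition bigwedge_act g : bigwedge_type -> bigwedge_type :=
  @wedge_fun _ wedge_summand (fun o => bg_pt (wedge_summand o)) bigwedge_type
    (fun o x => bigwedge_lift (bg_act (wedge_summand o) g x)).

Fact bigwedge_lift_act_pt g o o' :
  bigwedge_lift (bg_act (wedge_summand o) g (bg_pt (wedge_summand o))) =
  bigwedge_lift (bg_act (wedge_summand o') g (bg_pt (wedge_summand o'))).
Proof.
rewrite !bg_act_pt.
exact: (@wedge_liftE _ wedge_summand (fun o => bg_pt (wedge_summand o))
  o' (bg_pt _) o (bg_pt _)).
Qed.

Lemma bigwedge_actE g o (x : wedge_summand o) :
  bigwedge_act g (bigwedge_lift x) = bigwedge_lift (bg_act (wedge_summand o) g x).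
Proof.
rewrite /bigwedge_act /bigwedge_lift wedge_lift_funE //.
exact: bigwedge_lift_act_pt.
Qed.

Fact bigwedge_liftP (w : bigwedge_type) :
  exists o (x : wedge_summand o), w = bigwedge_lift x.
Proof.
have : [set: bigwedge_type] w by [].
by rewrite -wedgeTE; case=> o _ [x _ <-]; exists o, x.
Qed.

Fact bigwedge_act1 w : bigwedge_act 1%g w = w.
Proof.
by have [i [x ->]] := bigwedge_liftP w; rewrite bigwedge_actE bg_act1.
Qed.
Fact bigwedge_actM g h w :
  bigwedge_act (g * h)%g w = bigwedge_act g (bigwedge_act h w).
Proof.
by have [i [x ->]] := bigwedge_liftP w; rewrite !bigwedge_actE bg_actM.
Qed.
Fact bigwedge_act_pt g :
  bigwedge_act g (bigwedge_lift (bg_pt (wedge_summand None))) =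
  bigwedge_lift (bg_pt (wedge_summand None)).
Proof. by rewrite bigwedge_actE bg_act_pt. Qed.
Fact bigwedge_act_continuous g : continuous (bigwedge_act g).
Proof.
apply: wedge_fun_continuous; last exact: bigwedge_lift_act_pt.
move=> o x; apply: continuous_comp; first exact: bg_act_continuous.
exact: wedge_lift_continuous.
Qed.

Definition bigwedge : bgspace G :=
  BGSpace bigwedge_act1 bigwedge_actM bigwedge_act_pt bigwedge_act_continuous.

End bigwedge.

Section hom.
Variable G : topGroupType.

Definition expgz (x : G) (z : int) : G :=
  match z with
  | Posz m => (x ^+ m)%g
  | Negz m => (x ^- m.+1)%g
  end.

Variables (n : nat) (q : 'I_n -> int).

(* Hom(Z/(q_1) + ... + Z/(q_n), G) as a subspace of G^n, via the images of the
   standard generators; no condition on the order is imposed when q_i = 0. *)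
Definition hom_set : set {ptws 'I_n -> G} :=
  [set x | (forall i j, commute (x i) (x j)) /\
           (forall i, expgz (x i) (q i) = 1%g)].

Definition conj_tuple (g : G) (x : {ptws 'I_n -> G}) : {ptws 'I_n -> G} :=
  fun i => (g * x i * g^-1)%g.

Fact expgz_conj g x z :
  expgz (g * x * g^-1)%g z = (g * expgz x z * g^-1)%g.
Proof.
have e y : (g * y * g^-1 = y ^ (g^-1))%g by rewrite conjgE invgK mulgA.
by rewrite !e; case: z => m /=; rewrite ?conjVg conjXg.
Qed.

Fact hom_set_conj g x : hom_set x -> hom_set (conj_tuple g x).
Proof.
move=> [xC xq]; split=> [i j|i]; last first.
  by rewrite /conj_tuple expgz_conj xq mulg1 mulgV.
have e y : (g * y * g^-1 = y ^ (g^-1))%g by rewrite conjgE invgK mulgA.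
by rewrite /commute /conj_tuple !e -!conjMg xC.
Qed.

Fact hom_set1 : hom_set (fun _ => 1%g).
Proof.
split=> [i j|i]; first by rewrite /commute.
by case: (q i) => m /=; rewrite expg1n // invg1.
Qed.

Definition hom_type := set_type hom_set.
Definition hom_act (g : G) (x : hom_type) : hom_type :=
  exist _ (conj_tuple g (\val x)) (mem_set (hom_set_conj g (set_valP x))).
Definition hom_pt : hom_type := exist _ (fun _ => 1%g) (mem_set hom_set1).

Fact hom_act1 x : hom_act 1%g x = x.
Proof.
by apply/val_inj/funext => i; rewrite /= /conj_tuple mul1g invg1 mulg1.
Qed.
Fact hom_actM g h x : hom_act (g * h)%g x = hom_act g (hom_act h x).
Proof.
by apply/val_inj/funext => i; rewrite /= /conj_tuple invgM !mulgA.
Qed.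
Fact hom_act_pt g : hom_act g hom_pt = hom_pt.
Proof. by apply/val_inj/funext => i; rewrite /= /conj_tuple mulg1 mulgV. Qed.
Fact hom_act_continuous g : continuous (hom_act g).
Proof.
apply: continuous_set_type; apply: continuous_ptws => i.
have cx : continuous (fun x : hom_type => \val x i).
  move=> x; apply: (@continuous_comp _ _ _ (fun x : hom_type => \val x)
    (fun f : {ptws 'I_n -> G} => f i)); first exact: continuous_val.
  exact: (@proj_continuous _ (fun _ : 'I_n => G)).
apply: continuous_mulg; last exact: cst_continuous.
by apply: continuous_mulg => //; exact: cst_continuous.
Qed.

Definition hom_space : bgspace G :=
  BGSpace hom_act1 hom_actM hom_act_pt hom_act_continuous.

Definition S1 : set hom_space := [set x | exists i, \val x i = 1%g].

Fact S1_act g x : S1 x -> S1 (bg_act hom_space g x).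
Proof.
by move=> [i xi]; exists i; rewrite /= /conj_tuple xi mulg1 mulgV.
Qed.

Definition hom_mod_S1 : bgspace G := quotient_space S1_act.

End hom.

Definition Jset (n r : nat) :=
  {m : r.-tuple 'I_n | sorted ltn (map val m)}.

(* P_m(pi) is the sum of the Z/(q_i) for i in m. *)
Definition Porders (n r : nat) (q : 'I_n -> int) (m : Jset n r) : 'I_r -> int :=
  fun j => q (tnth (val m) j).

(* Main.v *)
Require Import Defs.
From HB Require Import structures.
From mathcomp Require Import all_boot all_order all_algebra.
From mathcomp Require Import generic_quotient complex spectral.
From mathcomp Require Import all_classical all_reals all_analysis homotopy.
From mathcomp Require Import ring lra.

Set Implicit Arguments.
Unset Strict Implicit.
Unset Printing Implicit Defensive.

Import Order.TTheory GRing.Theory Num.Theory.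
Import numFieldTopology.Exports numFieldNormedType.Exports.

Local Open Scope classical_set_scope.
Local Open Scope ring_scope.
Local Open Scope quotient_scope.

(* Replacing the k-th coordinate by 1 gives commuting equivariant idempotents
   e_k of X = Hom(pi, G), and the claim holds for any X with such idempotents
   whose images are suitably cofibrant.  For a single idempotent e with image E,
   the map "project to X / E, then apply e" from SX to S(X / E) v SE is a
   homotopy equivalence: on S(X / E) an inverse is the difference id - e in the
   co-H-structure of SX.  This difference is only null-homotopic on SE; it is
   made constant there by means of a deformation h of X and a function u that
   vanishes on E such that h_1 maps {u < 1} into E.  The idempotents e_k, the
   deformation h and (truncated) functions u_k pass to E and to X / E, so one
   concludes by induction on the number of idempotents.

   For Hom(pi, G) the deformation acts on each coordinate by a contraction of a
   neighborhood of 1 in G which is conjugation equivariant and preserves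
   commuting pairs: it scales the Cayley transform of a unitary matrix, and for
   SU(r) it corrects the determinant by a central factor.  When q_i <> 0, the
   neighborhood contains no solution of x^q_i = 1 other than 1. *)

(** * Products with the real line, gluing *)

Section topology_tools.

(** The cutoff by [u] works as follows. The path of id - e climbs along h_1 x and returns along e
    h_1 x, but only up to height min(1, u x). The halves meet at the top: if u x < 1, then h_1 x
    already lies in E; otherwise the top is the base point of the suspension. On E the height is 0,
    so the path is constant there and descends to X / E. Suspensions, quotients and wedges carry
    plain quotient topologies, without any CW structure. Homotopies on them are continuous because a
    quotient map times the locally compact line is again a quotient map. After n steps the summands
    are iterated images and quotients. They are compared with Hom(P_m)/S_1 through a universal
    property that passes along each step. A pattern of n booleans records the choices between
    quotient and image; for Hom(pi, G) the all-image pattern gives a point, so the wedge starts at r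
    = 1. *)

Lemma continuousT_comp (X Y Z : topologicalType) (f : X -> Y) (g : Y -> Z) :
  continuous f -> continuous g -> continuous (fun x => g (f x)).
Proof. by move=> cf cg x; apply: continuous_comp; [exact: cf|exact: cg]. Qed.

Lemma continuousT_id (X : topologicalType) : continuous (fun x : X => x).
Proof. by move=> x; exact: cvg_id. Qed.

Lemma fst_cts (X Y : topologicalType) : continuous (@fst X Y).
Proof. by move=> x; exact: cvg_fst. Qed.

Lemma snd_cts (X Y : topologicalType) : continuous (@snd X Y).
Proof. by move=> x; exact: cvg_snd. Qed.

Lemma continuousT_fst (Z X Y : topologicalType) (f : Z -> X * Y) :
  continuous f -> continuous (fun z => (f z).1).
Proof. by move=> cf; apply: (continuousT_comp cf); exact: fst_cts. Qed.

Lemma continuousT_snd (Z X Y : topologicalType) (f : Z -> X * Y) :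
  continuous f -> continuous (fun z => (f z).2).
Proof. by move=> cf; apply: (continuousT_comp cf); exact: snd_cts. Qed.

Lemma fst_fst_cts (X Y Z : topologicalType) : continuous (fun z : X * Y * Z => z.1.1).
Proof. exact: (continuousT_fst (@fst_cts _ _)). Qed.

Lemma fst_snd_cts (X Y Z : topologicalType) : continuous (fun z : X * Y * Z => z.1.2).
Proof. exact: (continuousT_snd (@fst_cts _ _)). Qed.

Section real_valued.
Variables (R : realType) (Z : topologicalType).
Implicit Types a b : Z -> R.

Lemma min_cts a b : continuous a -> continuous b -> continuous (fun z => Num.min (a z) (b z)).
Proof. by move=> ca cb z; apply: continuous_min; [exact: ca|exact: cb]. Qed.

Lemma max_cts a b : continuous a -> continuous b -> continuous (fun z => Num.max (a z) (b z)).
Proof. by move=> ca cb z; apply: continuous_max; [exact: ca|exact: cb]. Qed.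

Lemma add_cts a b : continuous a -> continuous b -> continuous (fun z => a z + b z).
Proof. by move=> ca cb z; apply: cvgD; [exact: ca|exact: cb]. Qed.

Lemma opp_cts a : continuous a -> continuous (fun z => - a z).
Proof. by move=> ca z; apply: cvgN; exact: ca. Qed.

Lemma mul_cts a b : continuous a -> continuous b -> continuous (fun z => a z * b z).
Proof. by move=> ca cb z; apply: cvgM; [exact: ca|exact: cb]. Qed.

End real_valued.

(** The universal property of a final topology, in a form that covers both a collapse map (one
    index) and the inclusions into a wedge. *)
Definition joint_final (I : Type) (X : I -> topologicalType) (W : topologicalType)
    (p : forall i, X i -> W) :=
  forall (Z : topologicalType) (g : W -> Z),
    (forall i, continuous (g \o p i)) -> continuous g.

(** By the exponential law: the transpose of [H], with values in the compact-open space of maps R ->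
    Y, can be tested on the pieces. Uncurrying uses that the line is locally compact and Hausdorff;
    surjectivity gives continuity of each [H (w, _)]. *)
Lemma joint_final_prod (R : realType) (I : Type) (X : I -> topologicalType)
    (W : topologicalType) (p : forall i, X i -> W) :
  joint_final p -> (forall w, exists i x, w = p i x) ->
  forall (Y : topologicalType) (H : W * R -> Y),
    (forall i, continuous (fun u : X i * R => H (p i u.1, u.2))) ->
    continuous H.
Proof.
move=> pfin psurj Y H cH; rewrite -[H]curryK.
apply: continuous_uncurry.
- exact: locally_compactR.
- exact: Rhausdorff.
- apply: (pfin {compact-open, R -> Y} (curry H)) => i.
  have -> : curry H \o p i = curry (fun u : X i * R => H (p i u.1, u.2)) by [].
  exact: continuous_curry_fun (cH i).
- move=> w; have [i [x ->]] := psurj w.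
  exact: (continuous_curry (cH i)).2 x.
Qed.

Lemma continuous_glue (R : realType) (Z Y : topologicalType) (a : Z -> R)
    (f g : Z -> Y) :
  continuous a -> continuous f -> continuous g ->
  (forall z, a z = 0 -> f z = g z) ->
  continuous (fun z => if a z <= 0 then f z else g z).
Proof.
move=> ca cf cg fg z; have [az|az|az] := ltgtP (a z) 0.
- have N : \forall w \near z, a w < 0.
    by apply: (cvgr_lt _ (ca z)).
  move=> A /=; rewrite (ltW az) => fA; rewrite nbhs_simpl.
  by apply: filterS (filterI N (cf z _ fA)) => w [aw fw] /=; rewrite ltW.
- have N : \forall w \near z, 0 < a w.
    by apply: (cvgr_gt _ (ca z)).
  move=> A /=; rewrite leNgt az => gA; rewrite nbhs_simpl.
  by apply: filterS (filterI N (cg z _ gA)) => w [aw fw] /=; rewrite leNgt aw.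
- move=> A /=; rewrite az lexx => fA.
  have gA := fA; rewrite (fg z az) in gA.
  have J : nbhs z (f @^-1` A `&` g @^-1` A).
    by apply: filterI; [exact: cf|exact: cg].
  by rewrite nbhs_simpl; apply: filterS J => w [fw gw] /=; case: ifP.
Qed.

End topology_tools.

(** * Equivariant homotopies, suspensions and wedges *)

Section unit_interval.
Variable R : realType.

Definition clamp (t : R) : R := Num.max 0 (Num.min 1 t).

Fact clamp_in t : clamp t \in `[0 : R, 1]%classic.
Proof. by rewrite inE /= in_itv /= /clamp le_max lexx /= ge_max ler01 ge_min lexx. Qed.

Definition clampI (t : R) : unit_itv R := exist _ (clamp t) (clamp_in t).

Lemma clamp_continuous : continuous clamp.
Proof.
move=> t; rewrite /clamp; apply: continuous_max; first exact: cvg_cst.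
by apply: continuous_min; [exact: cvg_cst|exact: cvg_id].
Qed.

Lemma clampI_continuous : continuous clampI.
Proof.
apply: (@continuous_set_type R R `[0 : R, 1]%classic clampI).
exact: clamp_continuous.
Qed.

Lemma clamp_id t : 0 <= t <= 1 -> clamp t = t.
Proof. by case/andP=> t0 t1; rewrite /clamp min_r // max_r. Qed.

Lemma clamp_le0 t : t <= 0 -> clamp t = 0.
Proof. by move=> t0; rewrite /clamp max_l // ge_min t0 orbT. Qed.

Lemma clamp_ge1 t : 1 <= t -> clamp t = 1.
Proof. by move=> t1; rewrite /clamp min_l // max_r. Qed.

Lemma unit_itvP (t : unit_itv R) : 0 <= \val t <= 1.
Proof. by have := set_valP t; rewrite /= in_itv. Qed.

Lemma clampI_val (t : unit_itv R) : clampI (\val t) = t.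
Proof. by apply/val_inj; rewrite /= clamp_id // unit_itvP. Qed.

End unit_interval.

Section homotopy.
Variables (R : realType) (G : topGroupType).

Lemma bgmap_id (X : bgspace G) : bgmap (@id X).
Proof. by split=> // x; exact: cvg_id. Qed.

Lemma bgmap_comp (X Y Z : bgspace G) (f : X -> Y) (g : Y -> Z) :
  bgmap f -> bgmap g -> bgmap (g \o f).
Proof.
move=> [cf ef pf] [cg eg pg]; split=> [x|k x|] /=.
- by apply: continuous_comp; [exact: cf|exact: cg].
- by rewrite ef eg.
- by rewrite pf pg.
Qed.

Lemma bgmap_cst (X Y : bgspace G) : bgmap (fun _ : X => bg_pt Y).
Proof. by split=> [|g x|] //=; [exact: cst_continuous|rewrite bg_act_pt]. Qed.

(** Time may run over the whole line: precompose with [clamp] in one direction, restrict in the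
    other. Homotopies on quotients then fall under [joint_final_prod]. *)
Lemma bghomotopicP (X Y : bgspace G) (f0 f1 : X -> Y) :
  bghomotopic R f0 f1 <->
  exists H : X * R -> Y,
    [/\ continuous H, forall t, bgmap (fun x => H (x, t)),
        forall x, H (x, 0) = f0 x & forall x, H (x, 1) = f1 x].
Proof.
split=> [[H [cH mH H0 H1]]|[H [cH mH H0 H1]]].
- exists (fun u => H (u.1, clampI u.2)); split=> [|t|x|x] /=.
  + apply: (continuousT_comp (g := H)) => //; apply: continuous_pair.
      exact: fst_cts.
    apply: (continuousT_comp (g := @clampI R)); last exact: clampI_continuous.
    exact: snd_cts.
  + exact: mH.
  + by apply: H0; rewrite /= clamp_id // lexx ler01.
  + by apply: H1; rewrite /= clamp_id // lexx ler01.
- exists (fun u => H (u.1, \val u.2)); split=> [|t|x t t0|x t t1] /=.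
  + apply: (continuousT_comp (g := H)) => //; apply: continuous_pair.
      exact: fst_cts.
    apply: (continuousT_comp (g := fun t : unit_itv R => \val t));
      last exact: continuous_val.
    exact: snd_cts.
  + exact: mH.
  + by rewrite t0.
  + by rewrite t1.
Qed.

Lemma bghomotopic_eq (X Y : bgspace G) (f0 f1 : X -> Y) :
  bgmap f0 -> f0 =1 f1 -> bghomotopic R f0 f1.
Proof.
move=> f0m e; apply/bghomotopicP; exists (fun u => f0 u.1); split=> //=.
by apply: continuousT_comp (bgmap_continuous f0m); exact: fst_cts.
Qed.

Lemma bghomotopic_trans (X Y : bgspace G) (f0 f1 f2 : X -> Y) :
  bghomotopic R f0 f1 -> bghomotopic R f1 f2 -> bghomotopic R f0 f2.
Proof.
move=> /bghomotopicP[H [cH mH H0 H1]] /bghomotopicP[K [cK mK K0 K1]].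
have comb (L : X * R -> Y) (a : R -> R) : continuous L -> continuous a ->
    continuous (fun u : X * R => L (u.1, a u.2)).
  move=> cL ca; apply: (continuousT_comp (g := L)) => //; apply: continuous_pair.
    exact: fst_cts.
  by apply: (continuousT_comp (g := a)) => //; exact: snd_cts.
have aff (b c : R) : continuous (fun t : R => b * t + c).
  by move=> t; apply: cvgD; [apply: cvgM; [exact: cvg_cst|exact: cvg_id]|exact: cvg_cst].
apply/bghomotopicP.
exists (fun u => if 2 * u.2 + (- 1) <= 0 then H (u.1, 2 * u.2 + 0) else K (u.1, 2 * u.2 + (- 1))).
split=> [|t|x|x] /=.
- apply: continuous_glue.
  + by apply: (continuousT_comp (g := fun t : R => 2 * t + - 1)) => //; exact: snd_cts.
  + exact: (comb H (fun t => 2 * t + 0)).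
  + exact: (comb K (fun t => 2 * t + - 1)).
  + move=> [x t] /= e; rewrite e K0.
    by have -> : 2 * t + 0 = 1 by [move/eqP: e; rewrite subr_eq0 addr0 => /eqP]; rewrite H1.
- by case: (2 * t - 1 <= 0); [exact: mH|exact: mK].
- by rewrite mulr0 !add0r (ltW (ltrN10 _)) H0.
- have -> : 2 * 1 - 1 = 1 :> R by ring.
  by rewrite ler10 K1.
Qed.

Lemma bghomotopic_comp (X Y Z W : bgspace G) (f0 f1 : X -> Y) (g : Y -> Z) (l : W -> X) :
  bgmap g -> bgmap l -> bghomotopic R f0 f1 -> bghomotopic R (g \o f0 \o l) (g \o f1 \o l).
Proof.
move=> gm lm /bghomotopicP[H [cH mH H0 H1]]; apply/bghomotopicP.
exists (fun u => g (H (l u.1, u.2))); split=> [|t|x|x] /=.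
- apply: continuousT_comp (bgmap_continuous gm).
  apply: (continuousT_comp (g := H)) => //; apply: continuous_pair.
    by apply: (continuousT_comp (g := l)); [exact: fst_cts|exact: bgmap_continuous lm].
  exact: snd_cts.
- exact: bgmap_comp (bgmap_comp lm (mH t)) gm.
- by rewrite H0.
- by rewrite H1.
Qed.

Definition bgheq (X Y : bgspace G) := exists f : X -> Y, bg_homotopy_equivalence R f.

Lemma bgheq_iso (X Y : bgspace G) (f : X -> Y) (g : Y -> X) :
  bgmap f -> bgmap g -> cancel f g -> cancel g f -> bgheq X Y.
Proof.
move=> fm gm fK gK; exists f; split=> //; exists g; split=> //.
- by apply: bghomotopic_eq => //; exact: bgmap_comp.
- by apply: bghomotopic_eq => //; exact: bgmap_comp.
Qed.

Lemma bgheq_sym (X Y : bgspace G) : bgheq X Y -> bgheq Y X.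
Proof. by move=> [f [fm [g [gm gf fg]]]]; exists g; split=> //; exists f. Qed.

Lemma bgheq_trans (X Y Z : bgspace G) : bgheq X Y -> bgheq Y Z -> bgheq X Z.
Proof.
move=> [f [fm [g [gm gf fg]]]] [f' [fm' [g' [gm' gf' fg']]]].
exists (f' \o f); split; first exact: bgmap_comp.
exists (g \o g'); split; first exact: bgmap_comp.
- apply: bghomotopic_trans gf.
  exact: (bghomotopic_comp gm fm gf').
- apply: bghomotopic_trans fg'.
  exact: (bghomotopic_comp fm' gm' fg).
Qed.

End homotopy.

(** * Maps and homotopies out of suspensions *)

Section suspension_maps.
Variables (R : realType) (G : topGroupType).

(** Every real height is accepted, and heights outside ]0, 1[ give the base point; affine
    reparametrizations and truncations then need no range conditions. *)
Definition sus (X : bgspace G) (x : X) (t : R) : susp R X :=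
  \pi_(collapse (@susp_collapsed R G X)) (x, clampI t).

Lemma sus_pi (X : bgspace G) (x : X) (t : unit_itv R) :
  \pi_(collapse (@susp_collapsed R G X)) (x, t) = sus x (\val t).
Proof. by rewrite /sus clampI_val. Qed.

Lemma sus_continuous (X : bgspace G) : continuous (fun u : X * R => sus u.1 u.2).
Proof.
apply: (@continuousT_comp _ (X * unit_itv R)%type _ (fun u : X * R => (u.1, clampI u.2))).
  apply: continuous_pair; first exact: fst_cts.
  by apply: (continuousT_comp (g := @clampI R));
    [exact: snd_cts|exact: clampI_continuous].
exact: pi_continuous.
Qed.

Lemma sus_cts (Z : topologicalType) (X : bgspace G) (a : Z -> X) (b : Z -> R) :
  continuous a -> continuous b -> continuous (fun z => sus (a z) (b z)).
Proof.
move=> ca cb.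
exact: (continuousT_comp (continuous_pair ca cb) (@sus_continuous X)).
Qed.

Lemma sus_pt (X : bgspace G) (x : X) (t : R) :
  [\/ t <= 0, 1 <= t | x = bg_pt X] -> sus x t = bg_pt (susp R X).
Proof.
move=> h; apply/collapse_eqP; right; split; last by apply: Or31.
by case: h => h; [apply: Or31; exact: clamp_le0|apply: Or32;
  exact: clamp_ge1|exact: Or33].
Qed.

Lemma sus_act (X : bgspace G) g (x : X) (t : R) :
  bg_act (susp R X) g (sus x t) = sus (bg_act X g x) t.
Proof. exact: (quotient_actE (@susp_collapsed_act R G X) g (x, clampI t)). Qed.

Lemma sus_surj (X : bgspace G) (w : susp R X) :
  exists x t, 0 <= t <= 1 /\ w = sus x t.
Proof.
elim/quotW: w => -[x t]; exists x, (\val t); split; first exact: unit_itvP.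
exact: sus_pi.
Qed.

Lemma sus_clamp (X : bgspace G) (x : X) (t : R) : sus x (clamp t) = sus x t.
Proof. exact: esym (sus_pi x (clampI t)). Qed.

Record susp_fun (X Y : bgspace G) (f : X * R -> Y) : Prop := SuspFun {
  susp_fun_continuous : continuous f;
  susp_fun_act : forall g x t, f (bg_act X g x, t) = bg_act Y g (f (x, t));
  susp_fun0 : forall x t, t <= 0 -> f (x, t) = bg_pt Y;
  susp_fun1 : forall x t, 1 <= t -> f (x, t) = bg_pt Y;
  susp_fun_pt : forall t, f (bg_pt X, t) = bg_pt Y
}.

Definition susp_lift (X Y : bgspace G) (f : X * R -> Y) (w : susp R X) : Y :=
  f ((repr w).1, \val (repr w).2).

Lemma susp_liftE (X Y : bgspace G) (f : X * R -> Y) x t :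
  susp_fun f -> susp_lift f (sus x t) = f (x, t).
Proof.
move=> [_ _ f0 f1 fpt].
have e (u : X * unit_itv R) : susp_collapsed u -> f (u.1, \val u.2) = bg_pt Y.
  by case: u => y s [/= ->|/= ->|/= ->] //; [exact: f0|exact: f1].
have -> : f (x, t) = f (x, clamp t).
  have [t0|/ltW t0] := leP t 0; first by rewrite clamp_le0 // !f0.
  have [t1|/ltW t1] := leP 1 t; first by rewrite clamp_ge1 // !f1.
  by rewrite clamp_id // t0.
have : \pi_(collapse (@susp_collapsed R G X)) (repr (sus x t)) = sus x t by rewrite reprK.
rewrite /susp_lift; move/collapse_eqP => [-> //|[/e -> /e /= -> //]].
Qed.

Lemma susp_lift_bgmap (X Y : bgspace G) (f : X * R -> Y) :
  susp_fun f -> bgmap (susp_lift f).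
Proof.
move=> fs; split.
- apply/(@quotient_continuous _ (collapse (@susp_collapsed R G X))).
  have -> : susp_lift f \o \pi_(collapse (@susp_collapsed R G X)) =
      (fun u : X * unit_itv R => f (u.1, \val u.2)).
    apply/funext => -[x t] /=; by rewrite sus_pi susp_liftE.
  apply: (continuousT_comp (g := f)); last exact: susp_fun_continuous fs.
  apply: continuous_pair; first exact: fst_cts.
  by apply: (continuousT_comp (g := fun t : unit_itv R => \val t));
    [exact: snd_cts|exact: continuous_val].
- move=> g w; have [x [t [t01 ->]]] := sus_surj w.
  by rewrite sus_act !susp_liftE // (susp_fun_act fs).
- have <- : sus (bg_pt X) 0 = bg_pt (susp R X) by apply: sus_pt; exact: Or33.
  by rewrite susp_liftE // (susp_fun_pt fs).
Qed.

Lemma susp_fun_bgmap (X Y : bgspace G) (f : susp R X -> Y) :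
  bgmap f -> susp_fun (fun u => f (sus u.1 u.2)).
Proof.
move=> fm; have f0 := bgmap_pt fm; split=> [|g x t|x t t0|x t t1|t] /=.
- by apply: (continuousT_comp (g := f)); [exact: sus_continuous|exact: bgmap_continuous fm].
- by rewrite -sus_act (bgmap_equivariant fm).
- by rewrite sus_pt //; exact: Or31.
- by rewrite sus_pt //; exact: Or32.
- by rewrite sus_pt //; exact: Or33.
Qed.

Lemma susp_liftK (X Y : bgspace G) (f : susp R X -> Y) :
  bgmap f -> susp_lift (fun u => f (sus u.1 u.2)) = f.
Proof.
move=> fm; apply/funext => w; have [x [t [t01 ->]]] := sus_surj w.
by rewrite susp_liftE //; exact: susp_fun_bgmap.
Qed.

(** Continuity on the suspension times the line is tested before the collapse, by
    [joint_final_prod]. The time is clamped, so only s in [0, 1] matters in the second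
    hypothesis. *)
Lemma susp_homotopy (X Y : bgspace G) (F : X * R * R -> Y) :
  continuous F -> (forall s, 0 <= s <= 1 -> susp_fun (fun u => F (u, s))) ->
  bghomotopic R (susp_lift (fun u => F (u, 0))) (susp_lift (fun u => F (u, 1))).
Proof.
move=> cF Fs'; have Fs s : susp_fun (fun u => F (u, clamp s)).
  by apply: Fs'; have := clamp_in s; rewrite inE /= in_itv.
apply/bghomotopicP.
exists (fun u => susp_lift (fun v => F (v, clamp u.2)) u.1); split=> [|s|w|w].
- apply: (@joint_final_prod R unit (fun _ => (X * unit_itv R)%type) (susp R X)
    (fun _ => \pi_(collapse (@susp_collapsed R G X)))).
  + move=> Z g /(_ tt) cg.
    exact/(@quotient_continuous _ (collapse (@susp_collapsed R G X))).
  + move=> w; exists tt, (repr w); by rewrite reprK.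
  + move=> _.
    have -> : (fun u : X * unit_itv R * R => susp_lift (fun v => F (v, clamp u.2))
        (\pi_(collapse (@susp_collapsed R G X)) u.1)) =
        (fun u => F ((u.1.1, \val u.1.2), clamp u.2)).
      by apply/funext => -[[x t] s] /=; rewrite sus_pi (susp_liftE _ _ (Fs s)).
    apply: (continuousT_comp (g := F)) => //; apply: continuous_pair; last first.
      by apply: (continuousT_comp (g := @clamp R));
        [exact: snd_cts|exact: clamp_continuous].
    apply: continuous_pair; first exact: (continuousT_fst (fst_cts (Y := _))).
    apply: (continuousT_comp (g := fun t : unit_itv R => \val t));
      last exact: continuous_val.
    exact: (continuousT_snd (fst_cts (Y := _))).
- exact: (susp_lift_bgmap (Fs s)).
- by rewrite /= clamp_le0.
- by rewrite /= clamp_ge1.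
Qed.

Definition susp_map (X Y : bgspace G) (f : X -> Y) : susp R X -> susp R Y :=
  susp_lift (fun u => sus (f u.1) u.2).

Lemma susp_map_fun (X Y : bgspace G) (f : X -> Y) :
  bgmap f -> susp_fun (fun u => sus (f u.1) u.2).
Proof.
move=> fm; split=> [|g x t|x t t0|x t t1|t].
- apply: sus_cts; last exact: snd_cts.
  by apply: (continuousT_comp (g := f)); [exact: fst_cts|exact: bgmap_continuous fm].
- by rewrite sus_act -(bgmap_equivariant fm).
- by apply: sus_pt; exact: Or31.
- by apply: sus_pt; exact: Or32.
- by apply: sus_pt; apply: Or33; exact: bgmap_pt fm.
Qed.

Lemma susp_map_bgmap (X Y : bgspace G) (f : X -> Y) : bgmap f -> bgmap (susp_map f).
Proof. by move=> fm; exact/susp_lift_bgmap/susp_map_fun. Qed.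

Lemma susp_mapE (X Y : bgspace G) (f : X -> Y) x t :
  bgmap f -> susp_map f (sus x t) = sus (f x) t.
Proof. by move=> fm; rewrite /susp_map susp_liftE //; exact: susp_map_fun. Qed.

Lemma susp_iso (X Y : bgspace G) (f : X -> Y) (g : Y -> X) :
  bgmap f -> bgmap g -> cancel f g -> cancel g f -> bgheq R (susp R X) (susp R Y).
Proof.
move=> fm gm fK gK; apply: (bgheq_iso _ (susp_map_bgmap fm) (susp_map_bgmap gm)).
- by move=> w; have [x [t [_ ->]]] := sus_surj w; rewrite !susp_mapE // fK.
- by move=> w; have [x [t [_ ->]]] := sus_surj w; rewrite !susp_mapE // gK.
Qed.

End suspension_maps.

(** * Maps out of wedges, regrouping of wedges *)

Section wedge_maps.
Variables (R : realType) (G : topGroupType).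

Section one_family.
Variables (I : choiceType) (X : I -> bgspace G).

Definition winj (i : I) (x : X i) : bigwedge X := @bigwedge_lift G I X (Some i) x.

Lemma bigwedge_lift_pt o : @bigwedge_lift G I X o (bg_pt (wedge_summand X o)) = bg_pt (bigwedge X).
Proof.
exact: (@wedge_liftE _ (wedge_summand X) (fun o => bg_pt (wedge_summand X o))
  None (bg_pt _) o (bg_pt _)).
Qed.

Lemma winj_bgmap i : bgmap (@winj i).
Proof.
split=> [|g x|].
- exact: (@wedge_lift_continuous _ (wedge_summand X) (fun o => bg_pt (wedge_summand X o)) (Some i)).
- exact: esym (@bigwedge_actE G I X g (Some i) x).
- exact: (bigwedge_lift_pt (Some i)).
Qed.

Lemma bigwedge_case (w : bigwedge X) :
  w = bg_pt (bigwedge X) \/ exists i x, w = @winj i x.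
Proof.
have [[i|] [x ->]] := bigwedge_liftP w; first by right; exists i, x.
by left; case: x.
Qed.

Definition wdesc (Y : bgspace G) (f : forall i, X i -> Y) : bigwedge X -> Y :=
  @wedge_fun _ (wedge_summand X) (fun o => bg_pt (wedge_summand X o)) Y
    (fun o => match o return wedge_summand X o -> Y with
              | Some i => f i
              | None => fun _ => bg_pt Y
              end).

Lemma wdesc_branch_pt (Y : bgspace G) (f : forall i, X i -> Y) o o' :
  (forall i, bgmap (f i)) ->
  (match o return wedge_summand X o -> Y with
   | Some i => f i | None => fun _ => bg_pt Y end) (bg_pt (wedge_summand X o)) =
  (match o' return wedge_summand X o' -> Y with
   | Some i => f i | None => fun _ => bg_pt Y end) (bg_pt (wedge_summand X o')).
Proof.
by move=> fm; case: o o' => [i|] [j|] //=; rewrite ?(bgmap_pt (fm _)).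
Qed.

Lemma wdescE (Y : bgspace G) (f : forall i, X i -> Y) :
  (forall i, bgmap (f i)) -> forall i x, wdesc f (@winj i x) = f i x.
Proof.
move=> fm i x; rewrite /wdesc /winj /bigwedge_lift wedge_lift_funE // => o o'.
exact: wdesc_branch_pt.
Qed.

Lemma wdesc_pt (Y : bgspace G) (f : forall i, X i -> Y) :
  (forall i, bgmap (f i)) -> wdesc f (bg_pt (bigwedge X)) = bg_pt Y.
Proof.
move=> fm; rewrite /wdesc /= /bigwedge_lift wedge_lift_funE // => o o'.
exact: wdesc_branch_pt.
Qed.

Lemma wdesc_bgmap (Y : bgspace G) (f : forall i, X i -> Y) :
  (forall i, bgmap (f i)) -> bgmap (wdesc f).
Proof.
move=> fm; split=> [|g w|]; last exact: wdesc_pt.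
- apply: wedge_fun_continuous => [[i|]|o o']; first exact: bgmap_continuous (fm i).
    exact: cst_continuous.
  exact: wdesc_branch_pt.
- have [->|[i [x ->]]] := bigwedge_case w.
    by rewrite bg_act_pt (wdesc_pt fm) bg_act_pt.
  by rewrite -(bgmap_equivariant (winj_bgmap i)) !(wdescE fm) (bgmap_equivariant (fm i)).
Qed.

Lemma bigwedge_joint_final :
  @joint_final (option I) (wedge_summand X) (bigwedge X) (@bigwedge_lift G I X).
Proof.
move=> Z g cg; apply/continuousP => U oU.
by apply/wedge_openP => o; move/continuousP: (cg o); exact.
Qed.

Lemma bgmap_wedge_eq (Y : bgspace G) (f g : bigwedge X -> Y) :
  bgmap f -> bgmap g -> (forall i x, f (@winj i x) = g (winj x)) -> f =1 g.
Proof.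
move=> fm gm fg w; have [->|[i [x ->]]] := bigwedge_case w; last exact: fg.
by rewrite !bgmap_pt.
Qed.

Lemma wdesc_homotopy (Y : bgspace G) (f g : forall i, X i -> Y) :
  (forall i, bghomotopic R (f i) (g i)) -> bghomotopic R (wdesc f) (wdesc g).
Proof.
move=> /(_ _)/bghomotopicP/cid-/all_sig[H HP].
have Hm t i : bgmap (fun x => H i (x, t)) by have [_ + _ _] := HP i; exact.
apply/bghomotopicP; exists (fun u => wdesc (fun i x => H i (x, u.2)) u.1); split.
- apply: (@joint_final_prod R _ (wedge_summand X) (bigwedge X) (@bigwedge_lift G I X)).
  + exact: bigwedge_joint_final.
  + exact: bigwedge_liftP.
  + move=> [i|].
      have -> : (fun u : X i * R => wdesc (fun i x => H i (x, u.2)) (@bigwedge_lift G I X (Some i) u.1)) = H i.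
        by apply/funext => -[x t]; rewrite (wdescE (Hm t)).
      by have [] := HP i.
    have -> : (fun u : wedge_summand X None * R => wdesc (fun i x => H i (x, u.2))
        (@bigwedge_lift G I X None u.1)) = fun _ => bg_pt Y.
      by apply/funext => -[[] t] /=; exact: (wdesc_pt (Hm t)).
    exact: cst_continuous.
- by move=> t; exact: (wdesc_bgmap (Hm t)).
- by move=> w /=; congr (wdesc _ w); apply: functional_extensionality_dep => i;
    apply/funext => x; have [_ _ + _] := HP i; exact.
- by move=> w /=; congr (wdesc _ w); apply: functional_extensionality_dep => i;
    apply/funext => x; have [_ _ _ +] := HP i; exact.
Qed.

Lemma wdescK (Y : bgspace G) (f : bigwedge X -> Y) :
  bgmap f -> wdesc (fun i => f \o @winj i) = f.
Proof.
move=> fm; have cm i : bgmap (f \o @winj i) by exact: bgmap_comp (winj_bgmap i) fm.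
by apply/funext/bgmap_wedge_eq => // [|i x]; [exact: wdesc_bgmap|rewrite wdescE].
Qed.

End one_family.

Lemma bigwedge_heq (I : choiceType) (X Y : I -> bgspace G) :
  (forall i, bgheq R (X i) (Y i)) -> bgheq R (bigwedge X) (bigwedge Y).
Proof.
move=> /(_ _)/cid-/all_sig[f fP].
have fm i : bgmap (f i) by have [] := fP i.
have /(_ _)/cid-/all_sig[g gP] : forall i, exists g, [/\ bgmap g,
    bghomotopic R (g \o f i) id & bghomotopic R (f i \o g) id].
  by move=> i; have [] := fP i.
have gm i : bgmap (g i) by have [] := gP i.
have Fm i : bgmap (@winj _ Y i \o f i) by exact: bgmap_comp (fm i) (winj_bgmap _ _).
have Gm i : bgmap (@winj _ X i \o g i) by exact: bgmap_comp (gm i) (winj_bgmap _ _).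
exists (wdesc (fun i => @winj _ Y i \o f i)); split; first exact: wdesc_bgmap.
exists (wdesc (fun i => @winj _ X i \o g i)); split; first exact: wdesc_bgmap.
- rewrite -(wdescK (bgmap_id (bigwedge X))).
  rewrite -(wdescK (bgmap_comp (wdesc_bgmap Fm) (wdesc_bgmap Gm))).
  apply: wdesc_homotopy => i.
  have -> : (wdesc (fun i => @winj _ X i \o g i) \o wdesc (fun i => @winj _ Y i \o f i)) \o @winj _ X i
     = @winj _ X i \o (g i \o f i) \o id.
    by apply/funext => x /=; rewrite wdescE //= wdescE.
  by have [_ h _] := gP i; exact: (bghomotopic_comp (winj_bgmap X i) (bgmap_id (X i)) h).
- rewrite -(wdescK (bgmap_id (bigwedge Y))).
  rewrite -(wdescK (bgmap_comp (wdesc_bgmap Gm) (wdesc_bgmap Fm))).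
  apply: wdesc_homotopy => i.
  have -> : (wdesc (fun i => @winj _ Y i \o f i) \o wdesc (fun i => @winj _ X i \o g i)) \o @winj _ Y i
     = @winj _ Y i \o (f i \o g i) \o id.
    by apply/funext => x /=; rewrite wdescE //= wdescE.
  by have [_ _ h] := gP i; exact: (bghomotopic_comp (winj_bgmap Y i) (bgmap_id (Y i)) h).
Qed.

Lemma bigwedge_assoc (I : choiceType) (J : I -> choiceType)
    (X : forall i, J i -> bgspace G) :
  bgheq R (bigwedge (fun i => bigwedge (X i)))
          (bigwedge (fun p : {i & J i} => X (tag p) (tagged p))).
Proof.
pose Y (p : {i & J i}) := X (tag p) (tagged p).
pose f i : bigwedge (X i) -> bigwedge Y :=
  wdesc (fun j => @winj _ Y (Tagged J j)).
pose g (p : {i & J i}) : Y p -> bigwedge (fun i => bigwedge (X i)) :=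
  @winj _ (fun i => bigwedge (X i)) (tag p) \o @winj _ (X (tag p)) (tagged p).
have fm i : bgmap (f i) by apply: wdesc_bgmap => j; exact: (winj_bgmap Y (Tagged J j)).
have gm p : bgmap (g p).
  exact: bgmap_comp (winj_bgmap (X (tag p)) (tagged p)) (winj_bgmap (fun i => bigwedge (X i)) (tag p)).
apply: (bgheq_iso R (wdesc_bgmap fm) (wdesc_bgmap gm)).
- apply: bgmap_wedge_eq.
  + exact: bgmap_comp (wdesc_bgmap fm) (wdesc_bgmap gm).
  + exact: bgmap_id.
  + move=> i; apply: bgmap_wedge_eq.
    * exact: (bgmap_comp (winj_bgmap (fun i => bigwedge (X i)) i)
        (bgmap_comp (wdesc_bgmap fm) (wdesc_bgmap gm))).
    * exact: winj_bgmap.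
    * move=> j x; rewrite /= (wdescE fm) /f wdescE;
        last by move=> ?; exact: (winj_bgmap Y (Tagged J _)).
      by rewrite (wdescE gm).
- apply: bgmap_wedge_eq.
  + exact: bgmap_comp (wdesc_bgmap gm) (wdesc_bgmap fm).
  + exact: bgmap_id.
  + move=> [i j] x /=; rewrite (wdescE gm) /= (wdescE fm) /f wdescE //.
    by move=> ?; exact: (winj_bgmap Y (Tagged J _)).
Qed.

Lemma bigwedge_reindex (I J : choiceType) (X : I -> bgspace G) (f : J -> I)
    (g : I -> J) :
  (forall i, f (g i) = i) -> injective f ->
  bgheq R (bigwedge (fun j => X (f j))) (bigwedge X).
Proof.
move=> fg finj.
pose F (j : J) : X (f j) -> bigwedge X := @winj _ X (f j).
(* [f (g i)] and [i] are equal only propositionally, so the inverse on the summand X i needs a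
   transport. *)
pose cst i j (e : i = j) (x : X i) : X j := eq_rect i X x j e.
have cstm i j (e : i = j) : bgmap (cst i j e).
  by case: j / e; exact: bgmap_id.
pose K (i : I) : X i -> bigwedge (fun j => X (f j)) :=
  @winj _ (fun j => X (f j)) (g i) \o cst _ _ (esym (fg i)).
have Fm j : bgmap (F j) by exact: winj_bgmap.
have Km i : bgmap (K i).
  exact: bgmap_comp (cstm _ _ _) (winj_bgmap (fun j => X (f j)) (g i)).
apply: (bgheq_iso R (wdesc_bgmap Fm) (wdesc_bgmap Km)).
- apply: bgmap_wedge_eq.
  + exact: bgmap_comp (wdesc_bgmap Fm) (wdesc_bgmap Km).
  + exact: bgmap_id.
  + move=> j x; rewrite /= (wdescE Fm) (wdescE Km) /K /=.
    have gf : g (f j) = j by apply: finj; rewrite fg.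
    move: (esym (fg (f j))); rewrite gf => e.
    by rewrite (eq_irrelevance e erefl).
- apply: bgmap_wedge_eq.
  + exact: bgmap_comp (wdesc_bgmap Km) (wdesc_bgmap Fm).
  + exact: bgmap_id.
  + move=> i x; rewrite /= (wdescE Km) /= (wdescE Fm) /F.
    by move: (esym (fg i)); case: _ /.
Qed.

(** The two maps are mutually inverse, so this is a homeomorphism. The forward map lives on the
    wedge times the line, where continuity again comes from [joint_final_prod]. *)
Lemma susp_bigwedge (I : choiceType) (X : I -> bgspace G) :
  bgheq R (susp R (bigwedge X)) (bigwedge (fun i => susp R (X i))).
Proof.
pose SX i := susp R (X i).
have gm i : bgmap (susp_map (R := R) (@winj _ X i)).
  by apply: susp_map_bgmap; exact: winj_bgmap.
pose f (u : bigwedge X * R) : bigwedge SX :=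
  wdesc (fun i x => @winj _ SX i (sus x (clamp u.2))) u.1.
have bm t i : bgmap (fun x => @winj _ SX i (sus x (clamp t))).
  split=> [|g x|].
  - apply: continuousT_comp (bgmap_continuous (winj_bgmap SX i)).
    by apply: sus_cts; [exact: continuousT_id|exact: cst_continuous].
  - by rewrite -sus_act (bgmap_equivariant (winj_bgmap SX i)).
  - by rewrite sus_pt; [exact: (bgmap_pt (winj_bgmap SX i))|exact: Or33].
have fs : susp_fun f.
  have aux t : (t <= 0 \/ 1 <= t) -> forall w, f (w, t) = bg_pt (bigwedge SX).
    move=> ht w; rewrite /f /=; have [->|[i [x ->]]] := bigwedge_case w.
      exact: (wdesc_pt (bm t)).
    rewrite (wdescE (bm t)) sus_clamp sus_pt; last by case: ht; [exact: Or31|exact: Or32].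
    exact: (bgmap_pt (winj_bgmap SX i)).
  split=> [|g w t|w t t0|w t t1|t].
  - apply: (@joint_final_prod R _ (wedge_summand X) (bigwedge X) (@bigwedge_lift G I X)).
    + exact: bigwedge_joint_final.
    + exact: bigwedge_liftP.
    + move=> [i|].
        have -> : (fun u : X i * R => f (@bigwedge_lift G I X (Some i) u.1, u.2)) =
            fun u => @winj _ SX i (sus u.1 u.2).
          by apply/funext => -[x t]; rewrite /f (wdescE (bm t)) sus_clamp.
        apply: continuousT_comp (bgmap_continuous (winj_bgmap SX i)).
        exact: sus_continuous.
      have -> : (fun u : wedge_summand X None * R =>
          f (@bigwedge_lift G I X None u.1, u.2)) = fun _ => bg_pt (bigwedge SX).
        by apply/funext => -[[] t] /=; exact: (wdesc_pt (bm t)).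
      exact: cst_continuous.
  - by rewrite /f /= (bgmap_equivariant (wdesc_bgmap (bm t))).
  - by apply: aux; left.
  - by apply: aux; right.
  - exact: (wdesc_pt (bm t)).
apply: (bgheq_iso R (susp_lift_bgmap fs) (wdesc_bgmap gm)).
- move=> w; have [x [t [t01 ->]]] := sus_surj w.
  rewrite (susp_liftE _ _ fs) /f /=; have [->|[i [y ->]]] := bigwedge_case x.
    rewrite (wdesc_pt (bm _)) (wdesc_pt gm) sus_pt //; exact: Or33.
  rewrite (wdescE (bm _)) (wdescE gm) susp_mapE; last exact: winj_bgmap.
  by rewrite sus_clamp.
- apply: bgmap_wedge_eq.
  + exact: bgmap_comp (wdesc_bgmap gm) (susp_lift_bgmap fs).
  + exact: bgmap_id.
  + move=> i w /=; rewrite (wdescE gm); have [x [t [t01 ->]]] := sus_surj w.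
    rewrite susp_mapE; last exact: winj_bgmap.
    by rewrite (susp_liftE _ _ fs) /f /= (wdescE (bm _)) sus_clamp.
Qed.

End wedge_maps.

(** * Maps and homotopies out of quotients *)

Section quotient_maps.
Variables (R : realType) (G : topGroupType) (X : bgspace G) (A : set X).
Hypothesis A_act : forall g x, A x -> A (bg_act X g x).

Definition qpi (x : X) : quotient_space A_act := \pi_(collapse A) x.

Lemma qpi_continuous : continuous qpi.
Proof. exact: pi_continuous. Qed.

Lemma qpi_bgmap : bgmap qpi.
Proof.
split=> //; first exact: qpi_continuous.
by move=> g x; exact: esym (quotient_actE A_act g x).
Qed.

Lemma qpi_surj (w : quotient_space A_act) : exists x, w = qpi x.
Proof. by elim/quotW: w => x; exists x. Qed.

Lemma qpi_eq x y : A x -> A y -> qpi x = qpi y.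
Proof. by move=> Ax Ay; apply/collapse_eqP; right. Qed.

Definition qlift (T : Type) (f : X -> T) (w : quotient_space A_act) : T := f (repr w).

Lemma qliftE (T : Type) (f : X -> T) x :
  (forall y z, A y -> A z -> f y = f z) -> qlift f (qpi x) = f x.
Proof.
move=> fA; have : \pi_(collapse A) (repr (qpi x)) = qpi x by rewrite reprK.
by rewrite /qlift => /collapse_eqP[-> //|[Ay Ax]]; exact: fA.
Qed.

Lemma qpi_joint_final : @joint_final unit (fun _ => X) (quotient_space A_act) (fun _ => qpi).
Proof. by move=> Z g /(_ tt) cg; exact/(@quotient_continuous _ (collapse A)). Qed.

Lemma qlift_continuous (Z : topologicalType) (f : X -> Z) :
  continuous f -> (forall y z, A y -> A z -> f y = f z) -> continuous (qlift f).
Proof.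
move=> cf fA; apply: qpi_joint_final => _.
by have -> : qlift f \o qpi = f by apply/funext => x /=; rewrite qliftE.
Qed.

Lemma qlift_bgmap (Y : bgspace G) (f : X -> Y) :
  bgmap f -> A (bg_pt X) -> (forall x, A x -> f x = bg_pt Y) -> bgmap (qlift f).
Proof.
move=> fm Apt fA.
have fA' y z : A y -> A z -> f y = f z by move=> Ay Az; rewrite !fA.
split=> [|g w|].
- exact: qlift_continuous (bgmap_continuous fm) fA'.
- have [x ->] := qpi_surj w; rewrite -(bgmap_equivariant qpi_bgmap) !qliftE //.
  exact: bgmap_equivariant fm g x.
- by rewrite -(bgmap_pt qpi_bgmap) qliftE // fA.
Qed.

(** Feeding this back into [joint_final_prod] handles a second real parameter, the time in
    homotopies of suspensions. *)
Lemma qpi_prod_final :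
  @joint_final unit (fun _ => X * R)%type (quotient_space A_act * R)%type
    (fun _ u => (qpi u.1, u.2)).
Proof.
move=> Z g /(_ tt) cg.
apply: (@joint_final_prod R unit (fun _ => X) (quotient_space A_act) (fun _ => qpi)) => //.
- exact: qpi_joint_final.
- by move=> w; have [x ->] := qpi_surj w; exists tt, x.
Qed.

Lemma qlift_prod_continuous (Z : topologicalType) (f : X * R -> Z) :
  continuous f -> (forall y z t, A y -> A z -> f (y, t) = f (z, t)) ->
  continuous (fun u : quotient_space A_act * R => f (repr u.1, u.2)).
Proof.
move=> cf fA; apply: qpi_prod_final => _.
have -> // : (fun u => f (repr u.1, u.2)) \o
    (fun u : X * R => (qpi u.1, u.2)) = f.
apply/funext => -[x t] /=; apply: (@qliftE _ (fun x => f (x, t))) => y z; exact: fA.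
Qed.

Lemma qlift_susp_fun (Y : bgspace G) (f : X * R -> Y) :
  susp_fun f -> (forall x t, A x -> f (x, t) = bg_pt Y) ->
  susp_fun (fun u : quotient_space A_act * R => f (repr u.1, u.2)).
Proof.
move=> fs fA.
have fA' y z t : A y -> A z -> f (y, t) = f (z, t) by move=> Ay Az; rewrite !fA.
have E x t : f (repr (qpi x), t) = f (x, t).
  by apply: (@qliftE _ (fun x => f (x, t))) => y z; exact: fA'.
split=> [|g w t|w t t0|w t t1|t].
- exact: qlift_prod_continuous (susp_fun_continuous fs) fA'.
- have [x ->] := qpi_surj w; rewrite -(bgmap_equivariant qpi_bgmap) /= !E.
  exact: susp_fun_act.
- exact: susp_fun0.
- exact: susp_fun1.
- by rewrite -(bgmap_pt qpi_bgmap) /= E; exact: susp_fun_pt.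
Qed.

Lemma qlift_susp_homotopy (Y : bgspace G) (F : X * R * R -> Y) :
  continuous F -> (forall s, 0 <= s <= 1 -> susp_fun (fun u => F (u, s))) ->
  (forall x t s, A x -> F (x, t, s) = bg_pt Y) ->
  bghomotopic R
    (susp_lift (fun u : quotient_space A_act * R => F (repr u.1, u.2, 0)))
    (susp_lift (fun u : quotient_space A_act * R => F (repr u.1, u.2, 1))).
Proof.
move=> cF Fs FA.
apply: (@susp_homotopy R G _ _
  (fun u : quotient_space A_act * R * R => F (repr u.1.1, u.1.2, u.2))).
- apply: (@joint_final_prod R unit (fun _ => X * R)%type (quotient_space A_act * R)%type
    (fun _ u => (qpi u.1, u.2))).
  + exact: qpi_prod_final.
  + by move=> -[w t]; have [x ->] := qpi_surj w; exists tt, (x, t).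
  + move=> _ /=.
    have -> // : (fun u : X * R * R => F (repr (qpi u.1.1), u.1.2, u.2)) = F.
    apply/funext => -[[x t] s] /=; apply: (@qliftE _ (fun x => F (x, t, s))) => y z Ay Az.
    by rewrite !FA.
- move=> s s01; apply: (qlift_susp_fun (Fs s s01)) => x t; exact: FA.
Qed.

End quotient_maps.

Section fixed_space.
Variables (G : topGroupType) (X : bgspace G) (e : X -> X).
Hypotheses (em : bgmap e) (eK : forall x, e (e x) = e x).

(** As [e] is idempotent, this is also its image, the subspace E of the overview. *)
Definition fix_set : set X := [set x | e x = x].

Fact fix_act g x : fix_set x -> fix_set (bg_act X g x).
Proof. by rewrite /fix_set /= => ex; rewrite (bgmap_equivariant em) ex. Qed.

Definition fix_space_act (g : G) (x : fix_set) : fix_set :=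
  exist _ (bg_act X g (\val x)) (mem_set (fix_act g (set_valP x))).
Definition fix_space_pt : fix_set := exist _ (bg_pt X) (mem_set (bgmap_pt em)).

Fact fix_space_act1 x : fix_space_act 1%g x = x.
Proof. by apply/val_inj; rewrite /= bg_act1. Qed.
Fact fix_space_actM g h x :
  fix_space_act (g * h)%g x = fix_space_act g (fix_space_act h x).
Proof. by apply/val_inj; rewrite /= bg_actM. Qed.
Fact fix_space_act_pt g : fix_space_act g fix_space_pt = fix_space_pt.
Proof. by apply/val_inj; rewrite /= bg_act_pt. Qed.
Fact fix_space_act_continuous g : continuous (fix_space_act g).
Proof.
apply: continuous_set_type => /=.
by apply: (continuousT_comp (g := bg_act X g));
  [exact: continuous_val|exact: bg_act_continuous].
Qed.

Definition fix_space : bgspace G :=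
  BGSpace fix_space_act1 fix_space_actM fix_space_act_pt fix_space_act_continuous.

Definition fix_incl (x : fix_space) : X := \val x.
Definition fix_retr (x : X) : fix_space := exist _ (e x) (mem_set (eK x)).

Lemma fix_incl_bgmap : bgmap fix_incl.
Proof. by split=> //; exact: continuous_val. Qed.

Lemma fix_inclP x : e (fix_incl x) = fix_incl x.
Proof. exact: set_valP x. Qed.

Lemma fix_retr_bgmap : bgmap fix_retr.
Proof.
split=> [|g x|].
- by apply: (@continuous_set_type X); exact: bgmap_continuous em.
- by apply/val_inj; rewrite /= (bgmap_equivariant em).
- by apply/val_inj; rewrite /= (bgmap_pt em).
Qed.

Lemma fix_inclK x : fix_retr (fix_incl x) = x.
Proof. by apply/val_inj; exact: fix_inclP. Qed.

Lemma fix_retrK x : fix_incl (fix_retr x) = e x.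
Proof. by []. Qed.

Lemma fix_retr_idem x : fix_retr (e x) = fix_retr x.
Proof. by apply/val_inj; rewrite /= eK. Qed.

Definition cofix_space : bgspace G := quotient_space fix_act.

End fixed_space.

Ltac cts := first [ assumption | lazymatch goal with
  | |- continuous (fun z => Order.min (@?a z) (@?b z)) =>
      apply: (@min_cts _ _ a b); cts
  | |- continuous (fun z => Order.max (@?a z) (@?b z)) =>
      apply: (@max_cts _ _ a b); cts
  | |- continuous (fun z => GRing.add (@?a z) (@?b z)) =>
      apply: (@add_cts _ _ a b); cts
  | |- continuous (fun z => GRing.mul (@?a z) (@?b z)) =>
      apply: (@mul_cts _ _ a b); cts
  | |- continuous (fun z => GRing.opp (@?a z)) => apply: (@opp_cts _ _ a); cts
  | |- continuous (fun _ => ?c) => exact: cst_continuous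
  | |- continuous (fun z => z.1.1) => exact: fst_fst_cts
  | |- continuous (fun z => z.1.2) => exact: fst_snd_cts
  | |- continuous (fun z => z.1) => exact: fst_cts
  | |- continuous (fun z => z.2) => exact: snd_cts
  | |- continuous fst => exact: fst_cts
  | |- continuous snd => exact: snd_cts
  | |- continuous _ => exact: continuousT_id
  end ].

Section pieces.
Variables (R : realType) (G : topGroupType) (X : bgspace G).

(** The real arguments are the suspension coordinate and the time. Nothing is required at the ends
    of the suspension, because a piece usually covers only part of the interval; the ends are
    checked after gluing by [piece_if]. *)
Record piece (Y : bgspace G) (w : X * R * R -> Y) : Prop := Piece {
  piece_continuous : continuous w;
  piece_act : forall g x t s, w (bg_act X g x, t, s) = bg_act Y g (w (x, t, s));
  piece_pt : forall t s, w (bg_pt X, t, s) = bg_pt Y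
}.

Lemma piece_cst (Y : bgspace G) : piece (fun _ => bg_pt Y).
Proof. by split=> [|g x t s|//]; [exact: cst_continuous|rewrite bg_act_pt]. Qed.

Lemma piece_comp (Y Z : bgspace G) (f : Y -> Z) (w : X * R * R -> Y) :
  bgmap f -> piece w -> piece (fun z => f (w z)).
Proof.
move=> fm [cw aw pw]; split=> [|g x t s|t s].
- exact: continuousT_comp cw (bgmap_continuous fm).
- by rewrite aw (bgmap_equivariant fm).
- by rewrite pw (bgmap_pt fm).
Qed.

Lemma piece_sus (Y : bgspace G) (a : X * R * R -> Y) (b : X * R * R -> R) :
  piece a -> continuous b ->
  (forall g x t s, b (bg_act X g x, t, s) = b (x, t, s)) ->
  piece (fun z => sus (a z) (b z)).
Proof.
move=> [ca aa pa] cb ab; split=> [|g x t s|t s].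
- exact: sus_cts.
- by rewrite sus_act aa ab.
- by apply: sus_pt; apply: Or33.
Qed.

Lemma piece_if (Y : bgspace G) (w w' : X * R * R -> Y) (a : X * R * R -> R) :
  continuous a -> (forall g x t s, a (bg_act X g x, t, s) = a (x, t, s)) ->
  piece w -> piece w' ->
  (forall z, a z = 0 -> w z = w' z) ->
  piece (fun z => if a z <= 0 then w z else w' z).
Proof.
move=> ca aa [cw aw pw] [cw' aw' pw'] ww'; split=> [|g x t s|t s].
- exact: continuous_glue.
- by rewrite aa; case: ifP => _; [exact: aw|exact: aw'].
- by rewrite pw pw'; case: ifP.
Qed.

Lemma piece_susp_fun (Y : bgspace G) (w : X * R * R -> Y) s :
  piece w ->
  (forall x t, t <= 0 -> w (x, t, s) = bg_pt Y) ->
  (forall x t, 1 <= t -> w (x, t, s) = bg_pt Y) ->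
  susp_fun (fun v => w (v, s)).
Proof.
move=> [cw aw pw] w0 w1; split=> [|g x t|x t t0|x t t1|t].
- apply: continuousT_comp cw.
  by apply: continuous_pair; cts.
- exact: aw.
- exact: w0.
- exact: w1.
- exact: pw.
Qed.

Lemma piece_homotopy (Y : bgspace G) (w : X * R * R -> Y) (f0 f1 : X * R -> Y) :
  piece w ->
  (forall x t s, 0 <= s <= 1 -> t <= 0 -> w (x, t, s) = bg_pt Y) ->
  (forall x t s, 0 <= s <= 1 -> 1 <= t -> w (x, t, s) = bg_pt Y) ->
  (forall x t, w (x, t, 0) = f0 (x, t)) ->
  (forall x t, w (x, t, 1) = f1 (x, t)) ->
  bghomotopic R (susp_lift f0) (susp_lift f1).
Proof.
move=> pw w0 w1 e0 e1; have cw := piece_continuous pw.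
have <- : (fun u => w (u, 0)) = f0 by apply/funext => -[x t]; rewrite e0.
have <- : (fun u => w (u, 1)) = f1 by apply/funext => -[x t]; rewrite e1.
by apply: susp_homotopy => // s s01; apply: piece_susp_fun => // x t;
  [exact: w0|exact: w1].
Qed.

Lemma piece_qhomotopy (A : set X) (A_act : forall g x, A x -> A (bg_act X g x))
    (Y : bgspace G) (w : X * R * R -> Y)
    (f0 f1 : quotient_space A_act * R -> Y) :
  piece w ->
  (forall x t s, 0 <= s <= 1 -> t <= 0 -> w (x, t, s) = bg_pt Y) ->
  (forall x t s, 0 <= s <= 1 -> 1 <= t -> w (x, t, s) = bg_pt Y) ->
  (forall x t s, A x -> w (x, t, s) = bg_pt Y) ->
  (forall x t, w (x, t, 0) = f0 (qpi A_act x, t)) ->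
  (forall x t, w (x, t, 1) = f1 (qpi A_act x, t)) ->
  bghomotopic R (susp_lift f0) (susp_lift f1).
Proof.
move=> pw w0 w1 wA e0 e1; have cw := piece_continuous pw.
have E (s t : R) x : w (repr (qpi A_act x), t, s) = w (x, t, s).
  by apply: (@qliftE _ _ _ _ _ (fun x => w (x, t, s))) => y z Ay Az; rewrite !wA.
have <- : (fun u : quotient_space A_act * R => w (repr u.1, u.2, 0)) = f0.
  by apply/funext => -[v t]; have [x ->] := qpi_surj v; rewrite E e0.
have <- : (fun u : quotient_space A_act * R => w (repr u.1, u.2, 1)) = f1.
  by apply/funext => -[v t]; have [x ->] := qpi_surj v; rewrite E e1.
by apply: qlift_susp_homotopy => // s s01; apply: piece_susp_fun => // x t;
  [exact: w0|exact: w1].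
Qed.

End pieces.

(** * Splitting along one idempotent *)

Ltac sus_end := apply: sus_pt => /=; solve
  [ apply: Or31; try (rewrite ge_min; apply/orP; left); lra
  | apply: Or32; try (rewrite le_max; apply/orP; left); lra ].

Section splitting_step.
Variables (R : realType) (G : topGroupType) (X : bgspace G).
Variables (e : X -> X) (h : X * R -> X) (u : X -> R).
Hypotheses (em : bgmap e) (eK : forall x, e (e x) = e x).
Hypotheses (hc : continuous h) (hm : forall t, bgmap (fun x => h (x, t))).
Hypotheses (h0 : forall x, h (x, 0) = x) (he : forall x t, h (e x, t) = e (h (x, t))).
Hypotheses (uc : continuous u) (ua : forall g x, u (bg_act X g x) = u x).
Hypotheses (u_ge0 : forall x, 0 <= u x) (ue : forall x, u (e x) = 0).
Hypothesis u_lt1 : forall x, u x < 1 -> e (h (x, 1)) = h (x, 1).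

Local Notation E := (fix_space em).
Local Notation Q := (cofix_space em).
Local Notation pi := (qpi (fix_act em)).
Local Notation retr := (fix_retr em eK).

Definition step_summand (b : bool) : bgspace G := if b then Q else E.
Local Notation SH := (fun b => susp R (step_summand b)).
Local Notation in1 := (@winj _ _ SH false).
Local Notation in2 := (@winj _ _ SH true).

Let pt_in : fix_set e (bg_pt X).
Proof. exact: bgmap_pt em. Qed.

Let pi_fix x : e x = x -> pi x = bg_pt Q.
Proof. by move=> ex; rewrite -(bgmap_pt (qpi_bgmap (fix_act em))); exact: qpi_eq. Qed.

Let h1_fix x : e x = x -> e (h (x, 1)) = h (x, 1).
Proof. by move=> ex; rewrite -he ex. Qed.

Let u_fix x : e x = x -> u x = 0.
Proof. by move=> <-. Qed.

Let in1_pt (w : susp R E) : w = bg_pt (susp R E) -> in1 w = bg_pt (bigwedge SH).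
Proof. by move=> ->; exact: (bgmap_pt (winj_bgmap SH false)). Qed.

Let in2_pt (w : susp R Q) : w = bg_pt (susp R Q) -> in2 w = bg_pt (bigwedge SH).
Proof. by move=> ->; exact: (bgmap_pt (winj_bgmap SH true)). Qed.

Let in1m : bgmap in1. Proof. exact: (winj_bgmap SH false). Qed.
Let in2m : bgmap in2. Proof. exact: (winj_bgmap SH true). Qed.

Let prj : piece (fun z : X * R * R => z.1.1).
Proof. by split=> //; cts. Qed.

Let ph (a : R * R -> R) : continuous a ->
  piece (fun z : X * R * R => h (z.1.1, a (z.1.2, z.2))).
Proof.
move=> ca; split=> [|g x t s|t s] /=.
- apply: (continuousT_comp (g := h)) => //; apply: continuous_pair; first by cts.
  by apply: (continuousT_comp (g := a)) => //; apply: continuous_pair; cts.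
- exact: bgmap_equivariant (hm _) g x.
- exact: bgmap_pt (hm _).
Qed.

Let uz : continuous (fun z : X * R * R => u z.1.1).
Proof. by apply: (continuousT_comp (g := u)) => //; cts. Qed.

(* The difference "identity minus e" in the group of maps out of a suspension,
   deformed so as to be constant on the image of e. *)
Definition susp_sub (x : X) (t : R) : susp R X :=
  if 2 * t - 1 <= 0 then sus (h (x, 1)) (Num.min (2 * t) (u x))
  else sus (e (h (x, 1))) (Num.min (2 - 2 * t) (u x)).

(** The sum, in the co-H-structure, of the projection to the quotient and the retraction to the
    image, kept apart in the wedge. *)
Definition splitting (x : X) (t : R) : bigwedge SH :=
  if 2 * t - 1 <= 0 then in2 (sus (pi x) (2 * t))
  else in1 (sus (retr x) (2 * t - 1)).

Lemma splitting_piece : piece (fun z : X * R * R => splitting z.1.1 z.1.2).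
Proof.
apply: (piece_if (a := fun z : X * R * R => 2 * z.1.2 - 1)) => //; first by cts.
- apply: (piece_comp in2m); apply: piece_sus => //; last by cts.
  exact: (piece_comp (qpi_bgmap (fix_act em)) prj).
- apply: (piece_comp in1m); apply: piece_sus => //; last by cts.
  exact: (piece_comp (fix_retr_bgmap em eK) prj).
- move=> [[x t] s] /= t0; by rewrite in1_pt ?in2_pt //; sus_end.
Qed.

Lemma splitting_le0 x t : t <= 0 -> splitting x t = bg_pt (bigwedge SH).
Proof.
by move=> t0; rewrite /splitting ifT; [rewrite in2_pt //; sus_end|lra].
Qed.

Lemma splitting_ge1 x t : 1 <= t -> splitting x t = bg_pt (bigwedge SH).
Proof.
move=> t1; rewrite /splitting ifF; last by apply/negbTE; rewrite -ltNge; lra.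
by rewrite in1_pt //; sus_end.
Qed.

Lemma splitting_susp_fun : susp_fun (fun v => splitting v.1 v.2).
Proof.
by apply: (piece_susp_fun (s := 0) splitting_piece) => x t;
  [exact: splitting_le0|exact: splitting_ge1].
Qed.

(** Used with m = u x where the halves of [susp_sub] meet, and with m = max(u x, s) to keep them
    joined while the cutoff is raised. *)
Lemma u_glue (m : R) x : u x <= m ->
  sus (h (x, 1)) (Num.min 1 m) = sus (e (h (x, 1))) (Num.min 1 m).
Proof.
move=> um; have [m1|m1] := ltP m 1; first by rewrite u_lt1 // (le_lt_trans um).
by rewrite !sus_pt //; apply: Or32.
Qed.

Let h1p : piece (fun z : X * R * R => h (z.1.1, 1)).
Proof. by apply: (ph (a := fun _ => 1)); cts. Qed.

Let eh1p : piece (fun z : X * R * R => e (h (z.1.1, 1))).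
Proof. exact: piece_comp em h1p. Qed.

Lemma susp_sub_piece : piece (fun z : X * R * R => susp_sub z.1.1 z.1.2).
Proof.
apply: (piece_if (a := fun z : X * R * R => 2 * z.1.2 - 1)) => //; first by cts.
- by apply: piece_sus => //; [cts|move=> *; rewrite /= ua].
- by apply: piece_sus => //; [cts|move=> *; rewrite /= ua].
- move=> [[x t] s] /= t0.
  have t2 : 2 * t = 1 by lra.
  have -> : 2 - 2 * t = 1 by lra.
  by rewrite t2; exact: u_glue.
Qed.

(** The height never exceeds u x = 0, so on E the path is constant and not merely null-homotopic. *)
Lemma susp_sub_fix x t : e x = x -> susp_sub x t = bg_pt (susp R X).
Proof.
move=> ex; rewrite /susp_sub (u_fix ex).
by case: ifP => _; apply: sus_pt; apply: Or31; rewrite ge_min lexx orbT.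
Qed.

Lemma susp_sub_susp_fun : susp_fun (fun v => susp_sub v.1 v.2).
Proof.
apply: (piece_susp_fun (s := 0) susp_sub_piece) => x t t0; rewrite /= /susp_sub.
- rewrite ifT; last by lra.
  by sus_end.
- rewrite ifF; last by apply/negbTE; rewrite -ltNge; lra.
  by sus_end.
Qed.

Let cofix_sub (v : Q * R) := susp_sub (repr v.1) v.2.

Lemma cofix_subE x t : cofix_sub (pi x, t) = susp_sub x t.
Proof.
apply: (@qliftE _ _ _ _ _ (fun x => susp_sub x t)) => y z ey ez.
by rewrite !susp_sub_fix.
Qed.

Lemma cofix_sub_susp_fun : susp_fun cofix_sub.
Proof.
apply: (@qlift_susp_fun _ _ _ _ (fix_act em) _ (fun v => susp_sub v.1 v.2)).
  exact: susp_sub_susp_fun.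
by move=> x t; exact: susp_sub_fix.
Qed.

Definition assembly (b : bool) : susp R (step_summand b) -> susp R X :=
  match b with
  | true => susp_lift cofix_sub
  | false => susp_map (@fix_incl _ _ _ em)
  end.

Lemma assembly_bgmap b : bgmap (assembly (b := b)).
Proof.
case: b => /=; first exact: susp_lift_bgmap cofix_sub_susp_fun.
exact: susp_map_bgmap (fix_incl_bgmap em).
Qed.

(** The composite is the truncated difference id - e followed by e. The homotopy lives on SX and not
    on S(X / E), so the cutoff may be removed although E then leaves the base point. *)
Lemma split_then_assemble :
  bghomotopic R (wdesc assembly \o susp_lift (fun v => splitting v.1 v.2)) id.
Proof.
have Fm : bgmap (susp_lift (fun v => splitting v.1 v.2)).
  exact: susp_lift_bgmap splitting_susp_fun.
rewrite -(susp_liftK (bgmap_comp Fm (wdesc_bgmap assembly_bgmap))).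
rewrite -(susp_liftK (bgmap_id (susp R X))).
(* The breakpoints 1/4 and 1/2 are those of the composite: [splitting] halves the interval and
   [susp_sub] halves the first half again. *)
pose three (w1 w2 w3 : X * R * R -> susp R X) (z : X * R * R) :=
  if 2 * z.1.2 - 1 <= 0 then (if 4 * z.1.2 - 1 <= 0 then w1 z else w2 z) else w3 z.
have threeP w1 w2 w3 : piece w1 -> piece w2 -> piece w3 ->
    (forall x t s, 4 * t = 1 -> w1 (x, t, s) = w2 (x, t, s)) ->
    (forall x t s, 2 * t = 1 -> w2 (x, t, s) = w3 (x, t, s)) ->
    piece (three w1 w2 w3).
  move=> p1 p2 p3 e12 e23.
  apply: (piece_if (a := fun z : X * R * R => 2 * z.1.2 - 1)) => //; first by cts.
    apply: (piece_if (a := fun z : X * R * R => 4 * z.1.2 - 1)) => //; first by cts.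
    by move=> [[x t] s] /= t0; apply: e12; lra.
  move=> [[x t] s] /= t0; rewrite ifF; last by apply/negbTE; rewrite -ltNge; lra.
  by apply: e23; lra.
have three0 w1 w2 w3 x t s : t <= 0 -> three w1 w2 w3 (x, t, s) = w1 (x, t, s).
  by move=> t0; rewrite /three /= !ifT //; lra.
have three1 w1 w2 w3 x t s : 1 <= t -> three w1 w2 w3 (x, t, s) = w3 (x, t, s).
  by move=> t1; rewrite /three /= ifF //; apply/negbTE; rewrite -ltNge; lra.
(* Raises the cutoff from u x to at least 1, where it no longer affects heights up to 1. *)
pose A := three
  (fun z => sus (h (z.1.1, 1)) (Num.min (4 * z.1.2) (Num.max (u z.1.1) z.2)))
  (fun z => sus (e (h (z.1.1, 1))) (Num.min (2 - 4 * z.1.2) (Num.max (u z.1.1) z.2)))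
  (fun z => sus (e z.1.1) (2 * z.1.2 - 1)).
(* Without the cutoff the pieces meet at the base point, so h can be run back from time 1 to time
   0. *)
pose B := three
  (fun z => sus (h (z.1.1, 1 - z.2)) (4 * z.1.2))
  (fun z => sus (e (h (z.1.1, 1 - z.2))) (2 - 4 * z.1.2))
  (fun z => sus (e z.1.1) (2 * z.1.2 - 1)).
(* Cancels -e against e: the descent and the following ascent along e x are lifted to height at
   least s, until at s = 1 they stay at the base point. *)
pose C := three
  (fun z => sus z.1.1 (4 * z.1.2))
  (fun z => sus (e z.1.1) (Num.max (2 - 4 * z.1.2) z.2))
  (fun z => sus (e z.1.1) (Num.max (2 * z.1.2 - 1) z.2)).
(* Slows the remaining path from speed 4 to speed 1. *)
pose D (z : X * R * R) := sus z.1.1 ((4 - 3 * z.2) * z.1.2).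
have ep : piece (fun z : X * R * R => e z.1.1) by exact: piece_comp em prj.
have Ap : piece A.
  apply: threeP.
  - by apply: piece_sus => //; [cts|move=> *; rewrite /= ua].
  - by apply: piece_sus => //; [cts|move=> *; rewrite /= ua].
  - by apply: piece_sus => //; cts.
  - move=> x t s t4 /=; rewrite t4 (_ : 2 - 1 = 1 :> R); last by lra.
    by apply: u_glue; rewrite le_max lexx.
  - move=> x t s t2; transitivity (bg_pt (susp R X)); last by symmetry; sus_end.
    by sus_end.
have hsp : piece (fun z : X * R * R => h (z.1.1, 1 - z.2)).
  by apply: (ph (a := fun z => 1 - z.2)); cts.
have Bp : piece B.
  apply: threeP.
  - by apply: piece_sus => //; cts.
  - by apply: piece_sus => //; [exact: piece_comp em hsp|cts].
  - by apply: piece_sus => //; cts.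
  - by move=> x t s t4; transitivity (bg_pt (susp R X)); [|symmetry]; sus_end.
  - by move=> x t s t2; transitivity (bg_pt (susp R X)); [|symmetry]; sus_end.
have Cp : piece C.
  apply: threeP.
  - by apply: piece_sus => //; cts.
  - by apply: piece_sus => //; cts.
  - by apply: piece_sus => //; cts.
  - by move=> x t s t4; transitivity (bg_pt (susp R X)); [|symmetry]; sus_end.
  - by move=> x t s t2 /=; congr (sus _ (Num.max _ _)); lra.
have Dp : piece D by apply: piece_sus => //; cts.
have start x t : A (x, t, 0) =
    (wdesc assembly \o susp_lift (fun v => splitting v.1 v.2)) (sus x t).
  rewrite /= susp_liftE; last exact: splitting_susp_fun.
  rewrite /A /three /splitting /=; case: (2 * t - 1 <= 0).
    rewrite (wdescE assembly_bgmap) /= (susp_liftE _ _ cofix_sub_susp_fun) cofix_subE.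
    rewrite /susp_sub (max_l (u_ge0 x)) (_ : 2 * (2 * t) = 4 * t) //; lra.
  by rewrite (wdescE assembly_bgmap) /= susp_mapE; last exact: fix_incl_bgmap.
apply: (@bghomotopic_trans _ _ _ _ _ (susp_lift (fun v => B (v, 0)))).
  apply: (piece_homotopy Ap) => [x t s s01 t0|x t s s01 t1|x t|x t].
  - by rewrite /A three0 //; sus_end.
  - by rewrite /A three1 //; sus_end.
  - exact: start.
  - rewrite /A /B /three /=; case: ifP => // t2; case: ifP => t4.
      by rewrite subr0 min_l // le_max; apply/orP; right; lra.
    rewrite subr0 min_l // le_max; apply/orP; right.
    by move/negbT: t4; rewrite -ltNge => t4; lra.
apply: (@bghomotopic_trans _ _ _ _ _ (susp_lift (fun v => C (v, 0)))).
  apply: (piece_homotopy Bp) => [x t s s01 t0|x t s s01 t1|x t|x t] //.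
  - by rewrite /B three0 //; sus_end.
  - by rewrite /B three1 //; sus_end.
  - rewrite /B /C /three /= subrr h0; case: ifP => t2; [case: ifP => // t4|].
      by rewrite max_l //; lra.
    by move/negbT: t2; rewrite -ltNge => t2; rewrite max_l //; lra.
apply: (@bghomotopic_trans _ _ _ _ _ (susp_lift (fun v => D (v, 0)))).
  apply: (piece_homotopy Cp) => [x t s s01 t0|x t s s01 t1|x t|x t] //.
  - by rewrite /C three0 //; sus_end.
  - by rewrite /C three1 //; sus_end.
  - rewrite /C /D /three /= mulr0 subr0; case: ifP => t2; [case: ifP => // /negbT|move/negbT: t2];
      rewrite -ltNge => t4; rewrite !sus_pt //; try (by apply: Or32; lra);
      by apply: Or32; rewrite le_max lexx orbT.
apply: (piece_homotopy Dp) => [x t s s01 t0|x t s s01 t1|x t|x t] //.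
- by case/andP: s01 => s0 s1; apply: sus_pt; apply: Or31; apply: mulr_ge0_le0 => /=; lra.
- case/andP: s01 => s0 s1; apply: sus_pt; apply: Or32 => /=.
  (* (4 - 3 s) t = t + 3 (1 - s) t, which is at least 1. *)
  have := mulr_ge0 (_ : 0 <= 1 - s) (_ : 0 <= t); nra.
- by rewrite /D /=; congr (sus _ _); lra.
Qed.

(** On the quotient summand the path makes a detour through SE, up and back the same way, which can
    be shrunk. On the image summand only the second half of [splitting] survives. *)
Lemma assemble_then_split :
  bghomotopic R (susp_lift (fun v => splitting v.1 v.2) \o wdesc assembly) id.
Proof.
have Fm : bgmap (susp_lift (fun v => splitting v.1 v.2)).
  exact: susp_lift_bgmap splitting_susp_fun.
have Am b : bgmap (susp_lift (fun v => splitting v.1 v.2) \o wdesc assembly \o @winj _ _ SH b).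
  exact: bgmap_comp (winj_bgmap SH b) (bgmap_comp (wdesc_bgmap assembly_bgmap) Fm).
rewrite -(wdescK (bgmap_comp (wdesc_bgmap assembly_bgmap) Fm)).
rewrite -(wdescK (bgmap_id (bigwedge SH))).
apply: wdesc_homotopy => -[].
- rewrite -(susp_liftK (Am true)) -[X in bghomotopic _ _ X](susp_liftK in2m).
  have FA x t : (susp_lift (fun v => splitting v.1 v.2) \o wdesc assembly) (in2 (sus (pi x) t)) =
      susp_lift (fun v => splitting v.1 v.2) (susp_sub x t).
    by rewrite /= (wdescE assembly_bgmap) /= (susp_liftE _ _ cofix_sub_susp_fun) cofix_subE.
  (* [splitting] at height [b], with the part in SE cut off at height 1 - s to shrink the detour. *)
  pose S (a : X * R * R -> X) (b : X * R * R -> R) (z : X * R * R) : bigwedge SH :=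
    if 2 * b z - 1 <= 0 then in2 (sus (pi (a z)) (2 * b z))
    else in1 (sus (retr (a z)) (Num.min (2 * b z - 1) (1 - z.2))).
  have Sp a b : piece a -> continuous b ->
      (forall g x t s, b (bg_act X g x, t, s) = b (x, t, s)) -> piece (S a b).
    move=> ap bc ba; apply: (piece_if (a := fun z => 2 * b z - 1)); first by cts.
    - by move=> g x t s; rewrite ba.
    - apply: (piece_comp in2m); apply: piece_sus; [|by cts|by move=> *; rewrite ba].
      exact: (piece_comp (qpi_bgmap (fix_act em)) ap).
    - apply: (piece_comp in1m); apply: piece_sus; [|by cts|by move=> *; rewrite ba].
      exact: (piece_comp (fix_retr_bgmap em eK) ap).
    - by move=> z z0; rewrite in1_pt ?in2_pt //; sus_end.
  pose A (z : X * R * R) := if 2 * z.1.2 - 1 <= 0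
    then S (fun z => h (z.1.1, 1)) (fun z => Num.min (2 * z.1.2) (u z.1.1)) z
    else S (fun z => e (h (z.1.1, 1))) (fun z => Num.min (2 - 2 * z.1.2) (u z.1.1)) z.
  (* Raises the cutoff; [pi] now sends E to the base point, which keeps the homotopy well defined on
     X / E. *)
  pose B (z : X * R * R) := if 2 * z.1.2 - 1 <= 0
    then in2 (sus (pi (h (z.1.1, 1))) (2 * Num.min (2 * z.1.2) (Num.max (u z.1.1) z.2)))
    else bg_pt (bigwedge SH).
  pose C (z : X * R * R) := in2 (sus (pi (h (z.1.1, 1 - z.2))) ((4 - 3 * z.2) * z.1.2)).
  have Sle a b z : b z <= 0 -> S a b z = bg_pt (bigwedge SH).
    by move=> b0; rewrite /S ifT; [rewrite in2_pt //; sus_end|lra].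
  have min_le0 (a b : R) : a <= 0 -> Num.min a b <= 0 by move=> a0; rewrite ge_min a0.
  have Ap : piece A.
    apply: (piece_if (a := fun z : X * R * R => 2 * z.1.2 - 1)) => //; first by cts.
    - by apply: Sp => //; [cts|move=> *; rewrite /= ua].
    - by apply: Sp => //; [cts|move=> *; rewrite /= ua].
    - move=> [[x t] s] /= t0; have t2 : 2 * t = 1 by lra.
      rewrite /S /= t2 (_ : 2 - 1 = 1 :> R); last by lra.
      have [u1|u1] := ltP (u x) 1; first by rewrite u_lt1.
      have -> : (2 * 1 - 1 <= 0 :> R) = false by apply/negbTE; rewrite -ltNge; lra.
      by rewrite fix_retr_idem.
  have pih1 : piece (fun z : X * R * R => pi (h (z.1.1, 1))).
    exact: (piece_comp (qpi_bgmap (fix_act em)) h1p).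
  have Bp : piece B.
    apply: (piece_if (a := fun z : X * R * R => 2 * z.1.2 - 1)) => //; first by cts.
    - apply: (piece_comp in2m); apply: piece_sus => //;
        [by cts|by move=> *; rewrite /= ua].
    - exact: piece_cst.
    - move=> [[x t] s] /= t0; have t2 : 2 * t = 1 by lra.
      rewrite in2_pt // t2; have [m1|m1] := ltP (Num.max (u x) s) 1.
        apply: sus_pt; apply: Or33; apply: pi_fix; apply: u_lt1.
        by apply: le_lt_trans m1; rewrite le_max lexx.
      by sus_end.
  have Cp : piece C.
    apply: (piece_comp in2m); apply: piece_sus => //; last by cts.
    have hsp : piece (fun z : X * R * R => h (z.1.1, 1 - z.2)).
      by apply: (ph (a := fun z => 1 - z.2)); cts.
    exact: (piece_comp (qpi_bgmap (fix_act em)) hsp).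
  pose f1 (v : Q * R) := B (repr v.1, v.2, 0).
  pose f2 (v : Q * R) := C (repr v.1, v.2, 0).
  have BE x t s : e x = x -> B (x, t, s) = bg_pt (bigwedge SH).
    move=> ex; rewrite /B /=; case: ifP => // _; rewrite in2_pt //.
    by apply: sus_pt; apply: Or33; apply: pi_fix; exact: h1_fix.
  have CE x t s : e x = x -> C (x, t, s) = bg_pt (bigwedge SH).
    move=> ex; rewrite /C /= in2_pt //.
    by apply: sus_pt; apply: Or33; apply: pi_fix; rewrite -he ex.
  have f1E x t : f1 (pi x, t) = B (x, t, 0).
    by apply: (@qliftE _ _ _ _ _ (fun x => B (x, t, 0))) => y z ey ez; rewrite !BE.
  have f2E x t : f2 (pi x, t) = C (x, t, 0).
    by apply: (@qliftE _ _ _ _ _ (fun x => C (x, t, 0))) => y z ey ez; rewrite !CE.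
  apply: (@bghomotopic_trans _ _ _ _ _ (susp_lift f1)).
    apply: (piece_qhomotopy Ap) => [x t s s01 t0|x t s s01 t1|x t s ex|x t|x t].
    + by rewrite /A /= ifT; [apply: Sle => /=; apply: min_le0; lra|lra].
    + rewrite /A /= ifF; last by apply/negbTE; rewrite -ltNge; lra.
      by apply: Sle => /=; apply: min_le0; lra.
    + by rewrite /A /=; case: ifP => _; apply: Sle; rewrite /= (u_fix ex) ge_min lexx orbT.
    + rewrite [RHS](FA x t) /susp_sub /A /= /S /= subr0.
      case: (2 * t - 1 <= 0); rewrite (susp_liftE _ _ splitting_susp_fun) /splitting /=;
        case: ifP => // _; congr in1; rewrite minEle; case: ifP => // /negbT;
        by rewrite -ltNge => m1; rewrite !sus_pt //; apply: Or32; rewrite ?lexx // ltW.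
    + rewrite f1E /A /B /S /= subrr; case: ifP => t2.
        rewrite (max_l (u_ge0 x)); case: ifP => // m1.
        rewrite in1_pt ?in2_pt //; apply: sus_pt.
          by apply: Or32; move/negbT: m1; rewrite -ltNge; lra.
        by apply: Or31; rewrite ge_min lexx orbT.
      case: ifP => _.
        by rewrite in2_pt //; apply: sus_pt; apply: Or33; apply: pi_fix; rewrite eK.
      by rewrite in1_pt //; apply: sus_pt; apply: Or31; rewrite ge_min lexx orbT.
  apply: (@bghomotopic_trans _ _ _ _ _ (susp_lift f2)).
    apply: (piece_qhomotopy Bp) => [x t s s01 t0|x t s s01 t1|x t s ex|x t|x t].
    + rewrite /B /= ifT; last by lra.
      rewrite in2_pt //; apply: sus_pt; apply: Or31.
      by rewrite pmulr_rle0 // min_le0 //; lra.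
    + by rewrite /B /= ifF //; apply/negbTE; rewrite -ltNge; lra.
    + exact: BE.
    + by rewrite f1E.
    + rewrite f2E /B /C /= mulr0 !subr0; case: ifP => t2.
        have -> : Num.min (2 * t) (Num.max (u x) 1) = 2 * t.
          by rewrite min_l // le_max; apply/orP; right; lra.
        by congr (in2 (sus _ _)); lra.
      symmetry; rewrite in2_pt //; apply: sus_pt; apply: Or32.
      by move/negbT: t2; rewrite -ltNge; lra.
  apply: (piece_qhomotopy Cp) => [x t s s01 t0|x t s s01 t1|x t s ex|x t|x t].
  + case/andP: s01 => s0 s1; rewrite /C /= in2_pt //; apply: sus_pt; apply: Or31.
    by apply: mulr_ge0_le0 => /=; lra.
  + case/andP: s01 => s0 s1; rewrite /C /= in2_pt //; apply: sus_pt; apply: Or32 => /=.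
    have := mulr_ge0 (_ : 0 <= 1 - s) (_ : 0 <= t); nra.
  + exact: CE.
  + by rewrite f2E.
  + by rewrite /C /= subrr h0; congr (in2 (sus _ _)); lra.
- rewrite -(susp_liftK (Am false)) -[X in bghomotopic _ _ X](susp_liftK in1m).
  have pEm : bgmap (@fix_incl _ _ _ em) by exact: fix_incl_bgmap.
  (* The straight line from the height 2t - 1, left over by the trivial first half, to the height
     t. *)
  pose A (z : E * R * R) := in1 (sus z.1.1 ((2 * z.1.2 - 1) * (1 - z.2) + z.1.2 * z.2)).
  have Ap : piece A.
    by apply: (piece_comp in1m); apply: piece_sus => //; [split=> //; cts|cts].
  apply: (piece_homotopy Ap) => [x t s s01 t0|x t s s01 t1|x t|x t].
  + case/andP: s01 => s0 s1; rewrite /A /= in1_pt //; apply: sus_pt; apply: Or31.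
    have a := mulr_le0_ge0 (_ : 2 * t - 1 <= 0) (_ : 0 <= 1 - s).
    have b := mulr_le0_ge0 t0 s0.
    by rewrite -(addr0 0) lerD // a //; lra.
  + case/andP: s01 => s0 s1; rewrite /A /= in1_pt //; apply: sus_pt; apply: Or32 => /=.
    have a := mulr_ge0 (_ : 0 <= 2 * t - 1 - 1) (_ : 0 <= 1 - s).
    have b := mulr_ge0 (_ : 0 <= t - 1) s0.
    have {}a : 0 <= (2 * t - 1 - 1) * (1 - s) by apply: a; lra.
    have {}b : 0 <= (t - 1) * s by apply: b; lra.
    lra.
  + rewrite /A /= (wdescE assembly_bgmap) /= susp_mapE //.
    rewrite (susp_liftE _ _ splitting_susp_fun) /splitting /= fix_inclK subr0 mulr1 mulr0 addr0.
    case: ifP => // t2; rewrite in1_pt; last by sus_end.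
    rewrite in2_pt //; apply: sus_pt; apply: Or33; apply: pi_fix; exact: fix_inclP.
  + by rewrite /A /= subrr mulr0 mulr1 add0r.
Qed.

Lemma susp_splitting : bgheq R (susp R X) (bigwedge SH).
Proof.
exists (susp_lift (fun v => splitting v.1 v.2)); split.
  exact: susp_lift_bgmap splitting_susp_fun.
exists (wdesc assembly); split.
- exact: wdesc_bgmap assembly_bgmap.
- exact: split_then_assemble.
- exact: assemble_then_split.
Qed.

End splitting_step.

(** * Splitting along commuting idempotents *)

Section iterated_splitting.
Variables (R : realType) (G : topGroupType).

(** The hypotheses of one splitting step for every e_i, with a single h shared by all. Indices run
    over nat, so that discarding the first idempotent is a shift. *)
Record split_data (X : bgspace G) (e : nat -> X -> X) (h : X * R -> X)
    (u : nat -> X -> R) : Prop := SplitData {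
  sd_map : forall i, bgmap (e i);
  sd_idem : forall i x, e i (e i x) = e i x;
  sd_comm : forall i j x, e i (e j x) = e j (e i x);
  sd_h_continuous : continuous h;
  sd_h_map : forall t, bgmap (fun x => h (x, t));
  sd_h0 : forall x, h (x, 0) = x;
  sd_he : forall i x t, h (e i x, t) = e i (h (x, t));
  sd_u_continuous : forall i, continuous (u i);
  sd_u_act : forall i g x, u i (bg_act X g x) = u i x;
  sd_u_ge0 : forall i x, 0 <= u i x;
  sd_ue : forall i x, u i (e i x) = 0;
  sd_u_lt1 : forall i x, u i x < 1 -> e i (h (x, 1)) = h (x, 1)
}.

Section halves.
Variables (X : bgspace G) (e : nat -> X -> X) (h : X * R -> X) (u : nat -> X -> R).
Hypothesis D : split_data e h u.

Local Notation em := (sd_map D 0).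
Local Notation E := (fix_space em).
Local Notation Q := (cofix_space em).
Local Notation pi := (qpi (fix_act em)).
Local Notation retr := (fix_retr em (sd_idem D 0)).
Local Notation incl := (@fix_incl _ _ _ em).

(** All the maps commute with [e 0], hence preserve its image; [retr] only changes the type of their
    values. *)
Lemma fix_split_data :
  split_data (fun i y => retr (e i.+1 (incl y))) (fun v : E * R => retr (h (incl v.1, v.2)))
    (fun i y => u i.+1 (incl y)).
Proof.
have fe i y : e 0 (e i (incl y)) = e i (incl y).
  by rewrite (sd_comm D) fix_inclP.
have fh y t : e 0 (h (incl y, t)) = h (incl y, t).
  by rewrite -(sd_he D) fix_inclP.
have im := fix_incl_bgmap em.
have rm := fix_retr_bgmap em (sd_idem D 0).
split=> [i|i y|i j y||t|y|i y t|i|i g y|i y|i y|i y].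
- exact: bgmap_comp (bgmap_comp im (sd_map D i.+1)) rm.
- by rewrite !fix_retrK !fe (sd_idem D).
- by rewrite !fix_retrK !fe (sd_comm D).
- apply: continuousT_comp (bgmap_continuous rm).
  apply: continuousT_comp (sd_h_continuous D); apply: continuous_pair; last by cts.
  by apply: continuousT_comp (bgmap_continuous im); cts.
- exact: bgmap_comp (bgmap_comp im (sd_h_map D t)) rm.
- by rewrite /= (sd_h0 D) fix_inclK.
- by rewrite /= !fix_retrK fe fh (sd_he D).
- apply: (continuousT_comp (g := u i.+1)); first exact: bgmap_continuous im.
  exact: (sd_u_continuous D).
- by rewrite (bgmap_equivariant im) (sd_u_act D).
- exact: sd_u_ge0 D _ _.
- by rewrite fix_retrK fe (sd_ue D).
- by move=> /(sd_u_lt1 D) uy; rewrite /= fix_retrK fh uy.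
Qed.

Let h_fix x t : e 0 x = x -> e 0 (h (x, t)) = h (x, t).
Proof. by move=> ex; rewrite -(sd_he D) ex. Qed.

Let pi_fix x : e 0 x = x -> pi x = bg_pt Q.
Proof.
move=> ex; rewrite -(bgmap_pt (qpi_bgmap (fix_act em))); apply: qpi_eq => //.
exact: bgmap_pt em.
Qed.

Definition cofix_e (i : nat) : Q -> Q := qlift (fun x => pi (e i.+1 x)).
Definition cofix_h (v : Q * R) : Q := pi (h (repr v.1, v.2)).
(** u_{i+1} need not be constant on the image of e_0; its minimum with u_0 vanishes there and so
    descends. *)
Definition cofix_u (i : nat) : Q -> R := qlift (fun x => Num.min (u i.+1 x) (u 0 x)).

Lemma cofix_eE i x : cofix_e i (pi x) = pi (e i.+1 x).
Proof.
rewrite /cofix_e qliftE // => y z ey ez; rewrite !pi_fix //.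
  by rewrite (sd_comm D) ez.
by rewrite (sd_comm D) ey.
Qed.

Lemma cofix_hE x t : cofix_h (pi x, t) = pi (h (x, t)).
Proof.
apply: (@qliftE _ _ _ _ _ (fun x => pi (h (x, t)))) => y z ey ez.
by rewrite !pi_fix // h_fix.
Qed.

Lemma cofix_uE i x : cofix_u i (pi x) = Num.min (u i.+1 x) (u 0 x).
Proof.
rewrite /cofix_u qliftE // => y z ey ez.
by rewrite -ey -ez !(sd_ue D) !min_r // (sd_u_ge0 D).
Qed.

Lemma cofix_split_data : split_data cofix_e cofix_h cofix_u.
Proof.
have pm := qpi_bgmap (fix_act em).
have fixpt : fix_set (e 0) (bg_pt X) by exact: bgmap_pt em.
have piP (P : Q -> Prop) : (forall x, P (pi x)) -> forall y, P y.
  by move=> Px y; have [x ->] := qpi_surj y.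
split=> [i|i|i j||t||i|i|i g|i|i|i].
- apply: qlift_bgmap => //; first exact: bgmap_comp (sd_map D i.+1) pm.
  by move=> x ex; rewrite pi_fix // (sd_comm D) ex.
- by apply: piP => x; rewrite !cofix_eE (sd_idem D).
- by apply: piP => x; rewrite !cofix_eE (sd_comm D).
- apply: (@qlift_prod_continuous _ _ _ _ (fix_act em) _ (fun v => pi (h v))).
    exact: continuousT_comp (sd_h_continuous D) (bgmap_continuous pm).
  by move=> y z t ey ez; rewrite !pi_fix // h_fix.
- apply: (@qlift_bgmap _ _ _ (fix_act em) _ (fun x => pi (h (x, t)))) => //.
    exact: bgmap_comp (sd_h_map D t) pm.
  by move=> x ex; rewrite pi_fix // h_fix.
- by apply: piP => x; rewrite cofix_hE (sd_h0 D).
- by apply: piP => x t; rewrite cofix_eE !cofix_hE cofix_eE (sd_he D).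
- apply: qlift_continuous.
    by apply: min_cts; exact: (sd_u_continuous D).
  move=> y z ey ez.
  by rewrite -ey -ez !(sd_ue D) !min_r // (sd_u_ge0 D).
- by apply: piP => x; rewrite -(bgmap_equivariant pm) !cofix_uE !(sd_u_act D).
- by apply: piP => x; rewrite cofix_uE le_min !(sd_u_ge0 D).
- by apply: piP => x; rewrite cofix_eE cofix_uE (sd_ue D) min_l // (sd_u_ge0 D).
- apply: piP => x; rewrite cofix_uE cofix_hE cofix_eE gt_min.
  case/orP => /(sd_u_lt1 D) ux; first by rewrite ux.
  (* Here u_0 x < 1, so h_1 x lies in the collapsed image of e_0 and both sides are the base
     point. *)
  by rewrite !pi_fix // (sd_comm D) ux.
Qed.

End halves.

(** The pattern [b] records for each idempotent whether its image is collapsed ([true]) or is the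
    part that determines f ([false]). *)
Definition respects (X Z : bgspace G) (n : nat) (b : nat -> bool)
    (e : nat -> X -> X) (f : X -> Z) : Prop :=
  forall k, (k < n)%N -> forall x, f (e k x) = if b k then bg_pt Z else f x.

(* For commuting idempotents e, this characterizes the quotient of the common
   image of the e k with b k false by the union of the images of the e k with
   b k true. *)
Definition is_summand (X Q : bgspace G) (n : nat) (b : nat -> bool)
    (e : nat -> X -> X) (p : X -> Q) : Prop :=
  [/\ bgmap p, forall q, exists x, q = p x, respects n b e p &
      forall (Z : bgspace G) (f : X -> Z), bgmap f -> respects n b e f ->
        exists2 f' : Q -> Z, bgmap f' & forall x, f x = f' (p x)].

Lemma bigwedge_unit (X : bgspace G) : bgheq R X (bigwedge (fun _ : unit => X)).
Proof.
have idm (i : unit) : bgmap (@id X) by exact: bgmap_id.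
apply: (bgheq_iso R (winj_bgmap (fun _ : unit => X) tt) (wdesc_bgmap idm)).
- by move=> x; rewrite (wdescE idm).
- apply: bgmap_wedge_eq.
  + exact: bgmap_comp (wdesc_bgmap idm) (winj_bgmap (fun _ : unit => X) tt).
  + exact: bgmap_id.
  + by move=> [] x; rewrite /= (wdescE idm).
Qed.

(** At most one pattern is left. If it is indexed, its summand is X itself; in the other case X is a
    point, and so are both sides. *)
Lemma iterated_splitting0 (I : choiceType) (Q : I -> bgspace G) (X : bgspace G)
    (p : forall i, X -> Q i) :
  (forall i j : I, i = j) ->
  (forall i, (forall q, exists x, q = p i x) /\ bgmap (p i) /\
     exists2 f : Q i -> X, bgmap f & forall x, x = f (p i x)) ->
  (exists i : I, True) \/ (forall x, x = bg_pt X) ->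
  bgheq R (susp R X) (bigwedge (fun i => susp R (Q i))).
Proof.
move=> I1 pP [[i _]|Xpt].
- have [psurj [pm [f fm fp]]] := pP i.
  apply: (bgheq_trans (Y := susp R (Q i))).
    apply: (susp_iso R pm fm) => [x|q]; first exact: esym (fp x).
    by have [x ->] := psurj q; rewrite -fp.
  apply: bgheq_trans (bigwedge_unit _) _.
  apply: (@bigwedge_reindex R G I unit (fun i => susp R (Q i)) (fun _ => i) (fun _ => tt)).
    by move=> j; exact: I1.
  by move=> [] [].
- have Qpt i (q : Q i) : q = bg_pt (Q i).
    have [psurj [pm _]] := pP i; have [x ->] := psurj q.
    by rewrite (Xpt x) (bgmap_pt pm).
  apply: (bgheq_iso R (bgmap_cst (susp R X) (bigwedge (fun i => susp R (Q i)))) (bgmap_cst _ _)).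
  + move=> w; have [x [t [_ ->]]] := sus_surj w.
    by rewrite sus_pt //; apply: Or33.
  + move=> w; have [->//|[i [v ->]]] := bigwedge_case w.
    have [x [t [_ ->]]] := sus_surj v.
    rewrite sus_pt; last by apply: Or33.
    exact/esym/(bgmap_pt (winj_bgmap (fun i => susp R (Q i)) i)).
Qed.

(** A respecting map is unchanged by e_0, so restriction to E and composition with the retraction
    are inverse to each other on such maps, and the universal property transfers. *)
Lemma fix_summand (X Q : bgspace G) (e : nat -> X -> X) (h : X * R -> X)
    (u : nat -> X -> R) (D : split_data e h u) n (b : nat -> bool) (p : X -> Q) :
  b 0 = false -> is_summand n.+1 b e p ->
  is_summand n (fun k => b k.+1)
    (fun k y => fix_retr (sd_map D 0) (sd_idem D 0) (e k.+1 (fix_incl y)))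
    (fun y => p (@fix_incl _ _ _ (sd_map D 0) y)).
Proof.
move=> b0 [pm psurj pe pU].
have im := fix_incl_bgmap (sd_map D 0).
have rm := fix_retr_bgmap (sd_map D 0) (sd_idem D 0).
have p0 x : p (e 0 x) = p x by rewrite pe // b0.
split=> [|q|k kn y|Z f fm fe].
- exact: bgmap_comp im pm.
- have [x ->] := psurj q; exists (fix_retr (sd_map D 0) (sd_idem D 0) x).
  by rewrite fix_retrK p0.
- by rewrite fix_retrK p0 pe.
- have [k kn x|f' fm' fE] := pU Z (fun x => f (fix_retr (sd_map D 0) (sd_idem D 0) x))
    (bgmap_comp rm fm).
    case: k kn => [|k] kn; first by rewrite b0 fix_retr_idem.
    rewrite -(fe k) // fix_retrK; congr f.
    by rewrite (sd_comm D) fix_retr_idem.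
  by exists f' => // y; rewrite -fE fix_inclK.
Qed.

(** A respecting map sends the image of e_0 to the base point, so it is the same as a map out of X /
    E. *)
Lemma cofix_summand (X Q : bgspace G) (e : nat -> X -> X) (h : X * R -> X)
    (u : nat -> X -> R) (D : split_data e h u) n (b : nat -> bool) (p : X -> Q) :
  b 0 = true -> is_summand n.+1 b e p ->
  is_summand n (fun k => b k.+1) (@cofix_e X e h u D)
    (qlift (A_act := fix_act (sd_map D 0)) p).
Proof.
move=> b0 [pm psurj pe pU].
have p0 x : e 0 x = x -> p x = bg_pt Q by move=> <-; rewrite pe // b0.
have pE x : qlift p (qpi (fix_act (sd_map D 0)) x) = p x.
  by apply: qliftE => y z ey ez; rewrite !p0.
have qm := qpi_bgmap (fix_act (sd_map D 0)).
have fixpt : fix_set (e 0) (bg_pt X) by exact: bgmap_pt (sd_map D 0).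
have e0pt x : qpi (fix_act (sd_map D 0)) (e 0 x) = bg_pt (cofix_space (sd_map D 0)).
  by rewrite -(bgmap_pt qm); apply: qpi_eq => //; exact: (sd_idem D 0 x).
split=> [|q|k kn y|Z f fm fe].
- by apply: qlift_bgmap => // x ex; rewrite p0.
- by have [x ->] := psurj q; exists (qpi (fix_act (sd_map D 0)) x); rewrite pE.
- by have [x ->] := qpi_surj y; rewrite cofix_eE !pE pe.
- have [k kn x|f' fm' fE] := pU Z (fun x => f (qpi (fix_act (sd_map D 0)) x))
    (bgmap_comp qm fm).
    case: k kn => [|k] kn; first by rewrite b0 e0pt (bgmap_pt fm).
    by rewrite -(cofix_eE D) fe.
  by exists f' => // y; have [x ->] := qpi_surj y; rewrite fE pE.
Qed.

(** Summands correspond to boolean patterns of length n. A pattern absent from [I] must contribute a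
    point, which is expressed by every respecting map being trivial. *)
Theorem iterated_splitting (n : nat) (X : bgspace G) (e : nat -> X -> X)
    (h : X * R -> X) (u : nat -> X -> R) (I : choiceType) (b : I -> nat -> bool)
    (Q : I -> bgspace G) (p : forall i, X -> Q i) :
  split_data e h u ->
  (forall i j, (forall k, (k < n)%N -> b i k = b j k) -> i = j) ->
  (forall i, is_summand n (b i) e (p i)) ->
  (forall c : nat -> bool, (exists i, forall k, (k < n)%N -> b i k = c k) \/
     forall (Z : bgspace G) (f : X -> Z), bgmap f -> respects n c e f ->
       forall x, f x = bg_pt Z) ->
  bgheq R (susp R X) (bigwedge (fun i => susp R (Q i))).
Proof.
elim: n X e h u I b Q p => [|n IH] X e h u I b Q p D binj pP call.
  apply: (iterated_splitting0 (p := p)) => [i j|i|]; first exact: binj.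
    have [pm psurj _ pU] := pP i; split=> //; split=> //.
    by have [|f fm fE] := pU X id (bgmap_id X); [|exists f].
  have [[i _]|triv] := call (fun _ => false); first by left; exists i.
  by right=> x; exact: (triv X id (bgmap_id X)).
(* The first bit decides whether a pattern goes to the quotient or to the image of e_0; the
   remaining bits serve in the induction. *)
pose J (c : bool) : choiceType := {i : I | b i 0 == c}.
apply: bgheq_trans.
  apply: (susp_splitting (sd_map D 0) (sd_idem D 0) (sd_h_continuous D) (sd_h_map D)
    (sd_h0 D) (sd_he D 0) (sd_u_continuous D (i := 0)) (sd_u_act D 0) (sd_u_ge0 D 0)
    (sd_ue D 0) (sd_u_lt1 D (i := 0))).
apply: (@bgheq_trans _ _ _ (bigwedge (fun c => bigwedge (fun i : J c => susp R (Q (val i)))))).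
  have Jinj c (i j : J c) : (forall k, (k < n)%N -> b (val i) k.+1 = b (val j) k.+1) -> i = j.
    move=> ij; apply/val_inj/binj => -[_|k kn]; last exact: ij.
    by rewrite (eqP (valP i)) (eqP (valP j)).
  apply: bigwedge_heq => -[].
  - apply: (IH _ _ _ _ (J true) (fun i k => b (val i) k.+1) _
      (fun i => qlift (A_act := fix_act (sd_map D 0)) (p (val i))) (cofix_split_data D)).
    + exact: Jinj.
    + by move=> i; apply: cofix_summand => //; exact/eqP/(valP i).
    + move=> c; pose c' k := if k is k'.+1 then c k' else true.
      have [[i ic]|triv] := call c'.
        have bi : b i 0 == true by rewrite ic.
        by left; exists (exist _ i bi) => k kn; rewrite /= ic.
      right=> Z f fm fe y; have [x ->] := qpi_surj y.
      have qm := qpi_bgmap (fix_act (sd_map D 0)).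
      apply: (triv Z (fun x => f (qpi (fix_act (sd_map D 0)) x)) (bgmap_comp qm fm)).
      move=> [|k] kn {}x /=; last by rewrite -(cofix_eE D) fe.
      rewrite -(bgmap_pt fm) -(bgmap_pt qm); congr f; apply: qpi_eq.
        exact: (sd_idem D 0 x).
      exact: bgmap_pt (sd_map D 0).
  - apply: (IH _ _ _ _ (J false) (fun i k => b (val i) k.+1) _
      (fun i y => p (val i) (@fix_incl _ _ _ (sd_map D 0) y)) (fix_split_data D)).
    + exact: Jinj.
    + by move=> i; apply: fix_summand => //; exact/eqP/(valP i).
    + move=> c; pose c' k := if k is k'.+1 then c k' else false.
      have [[i ic]|triv] := call c'.
        have bi : b i 0 == false by rewrite ic.
        by left; exists (exist _ i bi) => k kn; rewrite /= ic.
      right=> Z f fm fe y.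
      have rm := fix_retr_bgmap (sd_map D 0) (sd_idem D 0).
      rewrite -(fix_inclK (sd_idem D 0) y).
      apply: (triv Z (fun x => f (fix_retr (sd_map D 0) (sd_idem D 0) x))
        (bgmap_comp rm fm)).
      move=> [|k] kn x /=; first by rewrite fix_retr_idem.
      rewrite -(fe k) // fix_retrK; congr f.
      by rewrite (sd_comm D) fix_retr_idem.
apply: bgheq_trans.
  exact: (@bigwedge_assoc R G bool J (fun c i => susp R (Q (val i)))).
apply: (@bigwedge_reindex R G I {c : bool & J c} (fun i => susp R (Q i))
  (fun s => val (tagged s)) (fun i => Tagged J (exist _ i (eqxx (b i 0))))) => //.
move=> [c [i ic]] [c' [i' ic']] /= ii'; subst i'.
have cc : c = c' by rewrite -(eqP ic) -(eqP ic').
by subst c'; congr (Tagged J _); apply/val_inj.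
Qed.

End iterated_splitting.

(** * Contractions near the identity of the classical groups *)

Section complex_numbers.
Variable R : realType.
Local Notation C := (Cplx R).

Definition toC (x : R) : C := (x%:C)%C.
Definition re (z : C) : R := complex.Re z.
Definition im (z : C) : R := complex.Im z.

Lemma cplx_eta (z : C) : z = toC (re z) + 'i * toC (im z).
Proof. by rewrite {1}[z]complexE complexiE. Qed.

Lemma toC_continuous : continuous toC.
Proof.
move=> x A [e e0 eA].
have := e0; rewrite /= ltcE /= => /andP[/eqP eI e0'].
exists (complex.Re e) => // y xy; apply: eA => /=.
rewrite -rmorphB /= normc_def /= expr0n addr0 sqrtr_sqr ltcE /= eI eqxx /=.
exact: xy.
Qed.

Lemma re_le_norm (z : C) : toC `|re z| <= `|z|.
Proof. exact: normc_ge_Re. Qed.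

Lemma im_le_norm (z : C) : toC `|im z| <= `|z|.
Proof.
rewrite normc_def lecR -sqrtr_sqr ler_wsqrtr //.
by rewrite lerDr sqr_ge0.
Qed.

Lemma re_continuous : continuous re.
Proof.
move=> z A [e /= e0 eA]; exists (toC e); first by rewrite /= ltcR.
move=> w /= zw; apply: eA => /=; rewrite -ltcR.
apply: le_lt_trans zw; have := re_le_norm (z - w).
by rewrite /re /= raddfB.
Qed.

Lemma im_continuous : continuous im.
Proof.
move=> z A [e /= e0 eA]; exists (toC e); first by rewrite /= ltcR.
move=> w /= zw; apply: eA => /=; rewrite -ltcR.
apply: le_lt_trans zw; have := im_le_norm (z - w).
by rewrite /im /= raddfB.
Qed.

Lemma conj_toC x : (toC x)^* = toC x.
Proof. exact: conjc_real. Qed.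


Lemma im_conj z : im z^* = - im z.
Proof. by case: z. Qed.

Definition cis (x : R) : C := (cos x +i* sin x)%C.

Lemma cisD x y : cis (x + y) = cis x * cis y.
Proof.
by rewrite /cis cosD sinD; congr (_ +i* _)%C; rewrite addrC [cos x * sin y]mulrC mulrC.
Qed.

Lemma cis0 : cis 0 = 1.
Proof. by rewrite /cis cos0 sin0. Qed.

Lemma cisX x n : cis x ^+ n = cis (x *+ n).
Proof. by elim: n => [|n IH]; rewrite ?mulr0n ?cis0 // exprS mulrS cisD IH. Qed.

Lemma conj_cis x : (cis x)^* = cis (- x).
Proof. by rewrite /cis cosN sinN. Qed.

Lemma cis_unit x : cis x * (cis x)^* = 1.
Proof. by rewrite conj_cis -cisD subrr cis0. Qed.

Lemma cis_continuous : continuous cis.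
Proof.
have -> : cis = (fun x => toC (cos x) + 'i * toC (sin x)).
  by apply/funext => x; rewrite [LHS]cplx_eta.
move=> x; apply: cvgD.
  by apply: (continuous_comp (@continuous_cos R x)); exact: toC_continuous.
apply: cvgM; first exact: cvg_cst.
by apply: (continuous_comp (@continuous_sin R x)); exact: toC_continuous.
Qed.

(** For [0 < re z] this is the principal argument, and it is continuous there. *)
Definition arg (z : C) : R := atan (im z / re z).

Lemma arg_real z : im z = 0 -> arg z = 0.
Proof. by move=> z0; rewrite /arg z0 mul0r atan0. Qed.

(** For z = |z| e^(i theta) this reads e^(2 i theta) conj(z) = z. It provides the determinant
    correction for SU(r). *)
Lemma cis_argM2 z : 0 < re z -> cis (arg z *+ 2) * z^* = z.
Proof.
move=> z0.
have c0 : cos (arg z) != 0 by rewrite gt_eqF // cos_gt0_pihalf // atan_gtNpi2 atan_ltpi2.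
have tE : sin (arg z) = im z / re z * cos (arg z).
  by rewrite -[im z / re z]atanK /tan divfK.
have zr : z^* * cis (arg z) = z * (cis (arg z))^*.
  rewrite /cis tE; move: (cos (arg z)) => k.
  case: z z0 {c0 tE} => a b /= a0.
  apply/eqP; rewrite eq_complex /=; apply/andP; split; apply/eqP; first by ring.
  by field; rewrite gt_eqF.
by rewrite mulr2n cisD -mulrA [cis _ * z^*]mulrC zr mulrCA cis_unit mulr1.
Qed.

End complex_numbers.

Section matrix_continuity.
Variables (K : numFieldType) (Z : topologicalType).

Lemma entry_cts m n (f : Z -> 'M[K]_(m, n)) i j :
  continuous f -> continuous (fun z => f z i j).
Proof.
move=> cf; apply: (continuousT_comp (g := fun M : 'M[K]_(m, n) => M i j)) => //.
exact: mx_entry_continuous.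
Qed.

Lemma addK_cts (f g : Z -> K) :
  continuous f -> continuous g -> continuous (fun z => f z + g z).
Proof. by move=> cf cg z; apply: cvgD; [exact: cf|exact: cg]. Qed.

Lemma mulK_cts (f g : Z -> K) :
  continuous f -> continuous g -> continuous (fun z => f z * g z).
Proof. by move=> cf cg z; apply: cvgM; [exact: cf|exact: cg]. Qed.

Lemma oppK_cts (f : Z -> K) : continuous f -> continuous (fun z => - f z).
Proof. by move=> cf z; apply: cvgN; exact: cf. Qed.

Lemma invK_cts (f : Z -> K) :
  (forall z, f z != 0) -> continuous f -> continuous (fun z => (f z)^-1).
Proof. by move=> f0 cf z; apply: cvgV; [exact: f0|exact: cf]. Qed.

Lemma sum_cts (I : Type) (r : seq I) (P : pred I) (f : I -> Z -> K) :
  (forall i, continuous (f i)) -> continuous (fun z => \sum_(i <- r | P i) f i z).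
Proof.
by move=> cf z; apply: cvg_big => [|i _]; [exact: add_continuous|exact: cf].
Qed.

Lemma prod_cts (I : Type) (r : seq I) (P : pred I) (f : I -> Z -> K) :
  (forall i, continuous (f i)) -> continuous (fun z => \prod_(i <- r | P i) f i z).
Proof.
by move=> cf z; apply: cvg_big => [|i _]; [exact: mul_continuous|exact: cf].
Qed.

Lemma mulmx_cts m n p (f : Z -> 'M[K]_(m, n)) (g : Z -> 'M[K]_(n, p)) :
  continuous f -> continuous g -> continuous (fun z => f z *m g z).
Proof.
move=> cf cg; apply: continuous_mx => i j.
have -> : (fun z => (f z *m g z) i j) = fun z => \sum_k f z i k * g z k j.
  by apply/funext => z; rewrite mxE.
by apply: sum_cts => k; apply: mulK_cts; exact: entry_cts.
Qed.

Lemma addmx_cts m n (f g : Z -> 'M[K]_(m, n)) :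
  continuous f -> continuous g -> continuous (fun z => f z + g z).
Proof.
move=> cf cg; apply: continuous_mx => i j.
have -> : (fun z => (f z + g z) i j) = fun z => f z i j + g z i j.
  by apply/funext => z; rewrite mxE.
by apply: addK_cts; exact: entry_cts.
Qed.


Lemma scalemx_cts m n (a : Z -> K) (f : Z -> 'M[K]_(m, n)) :
  continuous a -> continuous f -> continuous (fun z => a z *: f z).
Proof.
move=> ca cf; apply: continuous_mx => i j.
have -> : (fun z => (a z *: f z) i j) = fun z => a z * f z i j.
  by apply/funext => z; rewrite mxE.
by apply: mulK_cts => //; exact: entry_cts.
Qed.

Lemma det_cts n (f : Z -> 'M[K]_n) : continuous f -> continuous (fun z => \det (f z)).
Proof.
move=> cf; apply: sum_cts => s; apply: mulK_cts; first exact: cst_continuous.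
by apply: prod_cts => i; exact: entry_cts.
Qed.

Lemma trace_cts n (f : Z -> 'M[K]_n) : continuous f -> continuous (fun z => \tr (f z)).
Proof. by move=> cf; apply: sum_cts => i; exact: entry_cts. Qed.

Lemma adj_cts n (f : Z -> 'M[K]_n) : continuous f -> continuous (fun z => \adj (f z)).
Proof.
move=> cf; apply: continuous_mx => i j.
have -> : (fun z => (\adj (f z)) i j) = fun z => (-1) ^+ (j + i) * \det (row' j (col' i (f z))).
  by apply/funext => z; rewrite mxE.
apply: mulK_cts; first exact: cst_continuous.
apply: det_cts; apply: continuous_mx => k l.
have -> : (fun z => row' j (col' i (f z)) k l) = fun z => f z (lift j k) (lift i l).
  by apply/funext => z; rewrite !mxE.
exact: entry_cts.
Qed.

Lemma invmx_cts n (f : Z -> 'M[K]_n) :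
  (forall z, \det (f z) != 0) -> continuous f -> continuous (fun z => invmx (f z)).
Proof.
move=> f0 cf.
have -> : (fun z => invmx (f z)) = fun z => (\det (f z))^-1 *: \adj (f z).
  by apply/funext => z; rewrite /invmx unitmxE unitfE f0.
by apply: scalemx_cts; [apply: invK_cts => //; exact: det_cts|exact: adj_cts].
Qed.

Lemma expmx_cts n (f : Z -> 'M[K]_n) k : continuous f -> continuous (fun z => f z ^+ k).
Proof.
move=> cf; elim: k => [|k IH]; first exact: cst_continuous.
have -> : (fun z => f z ^+ k.+1) = fun z => f z *m f z ^+ k.
  by apply/funext => z; rewrite exprS.
exact: mulmx_cts.
Qed.

Lemma summx_cts m n (I : Type) (r : seq I) (P : pred I) (f : I -> Z -> 'M[K]_(m, n)) :
  (forall i, continuous (f i)) -> continuous (fun z => \sum_(i <- r | P i) f i z).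
Proof.
move=> cf; apply: continuous_mx => i j.
have -> : (fun z => (\sum_(k <- r | P k) f k z) i j) = fun z => \sum_(k <- r | P k) f k z i j.
  by apply/funext => z; rewrite summxE.
by apply: sum_cts => k; exact: entry_cts.
Qed.

End matrix_continuity.

Section conj_transpose.
Local Open Scope sesquilinear_scope.
Variables (R : realType).
Local Notation C := (Cplx R).

Lemma trmxC_cts (Z : topologicalType) m n (f : Z -> 'M[C]_(m, n)) :
  continuous f -> continuous (fun z => (f z)^t*).
Proof.
move=> cf; apply: continuous_mx => i j.
have -> : (fun z => (f z)^t* i j) = fun z => (f z j i)^*.
  by apply/funext => z; rewrite !mxE.
by apply: continuousT_comp (@conj_continuous R); exact: entry_cts.
Qed.

Lemma trmxC_mul m n p (A : 'M[C]_(m, n)) (B : 'M[C]_(n, p)) :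
  (A *m B)^t* = B^t* *m A^t*.
Proof. by rewrite trmx_mul map_mxM. Qed.

Lemma trmxCD m n (A B : 'M[C]_(m, n)) : (A + B)^t* = A^t* + B^t*.
Proof. by rewrite linearD /= map_mxD. Qed.

Lemma trmxCZ m n a (A : 'M[C]_(m, n)) : (a *: A)^t* = a^* *: A^t*.
Proof. by rewrite linearZ /= map_mxZ. Qed.

Lemma trmxC_scalar n a : (a%:M : 'M[C]_n)^t* = (a^*)%:M.
Proof. by rewrite tr_scalar_mx map_scalar_mx. Qed.

Lemma det_trmxC n (A : 'M[C]_n) : \det (A^t*) = (\det A)^*.
Proof. by rewrite det_map_mx det_tr. Qed.

(** The squared Frobenius norm, chosen because unitary conjugation preserves it, which makes the
    cutoff functions invariant. *)
Definition sqnorm m n (A : 'M[C]_(m, n)) : R := re (\tr (A *m A^t*)).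

Lemma mxtrace_trmxC m n (A : 'M[C]_(m, n)) :
  \tr (A *m A^t*) = \sum_i \sum_j `|A i j| ^+ 2.
Proof.
apply: eq_bigr => i _; rewrite mxE; apply: eq_bigr => j _.
by rewrite !mxE normCK.
Qed.

Lemma toC_sqnorm m n (A : 'M[C]_(m, n)) : toC (sqnorm A) = \tr (A *m A^t*).
Proof.
apply: RRe_real; rewrite mxtrace_trmxC; apply: ger0_real.
by apply: sumr_ge0 => i _; apply: sumr_ge0 => j _; rewrite exprn_ge0.
Qed.

Lemma sqnorm_ge0 m n (A : 'M[C]_(m, n)) : 0 <= sqnorm A.
Proof.
rewrite -ler0c -/(toC _) toC_sqnorm mxtrace_trmxC.
by apply: sumr_ge0 => i _; apply: sumr_ge0 => j _; rewrite exprn_ge0.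
Qed.

Lemma entry_le_sqnorm m n (A : 'M[C]_(m, n)) i j : `|A i j| ^+ 2 <= toC (sqnorm A).
Proof.
rewrite toC_sqnorm mxtrace_trmxC (bigD1 i) //= (bigD1 j) //= -addrA lerDl.
apply: addr_ge0; first by apply: sumr_ge0 => l _; rewrite exprn_ge0.
by apply: sumr_ge0 => k _; apply: sumr_ge0 => l _; rewrite exprn_ge0.
Qed.

Lemma sqnorm0 m n : sqnorm (0 : 'M[C]_(m, n)) = 0.
Proof. by rewrite /sqnorm mul0mx mxtrace0. Qed.

Lemma sqnormZ m n a (A : 'M[C]_(m, n)) : sqnorm (toC a *: A) = a ^+ 2 * sqnorm A.
Proof.
apply: complexI; rewrite rmorphM rmorphXn /= -/(toC (sqnorm A)) -/(toC (sqnorm _)) -/(toC a).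
rewrite !toC_sqnorm trmxCZ conj_toC -scalemxAl -scalemxAr scalerA.
by rewrite mxtraceZ expr2.
Qed.

Lemma sqnorm_conj n (U A : 'M[C]_n) : U \is unitarymx ->
  sqnorm (U *m A *m U^t*) = sqnorm A.
Proof.
move=> uU; rewrite /sqnorm; congr re.
have UV : U^t* *m U = 1%:M by apply/mulmx1C/unitarymxP.
rewrite !trmxC_mul trmxCK !mulmxA -(mulmxA (U *m A) (U^t*) U) UV mulmx1.
by rewrite -(mulmxA U A) -mulmxA mxtrace_mulC -!mulmxA UV mulmx1.
Qed.

Lemma sqnorm_cts (Z : topologicalType) m n (f : Z -> 'M[C]_(m, n)) :
  continuous f -> continuous (fun z => sqnorm (f z)).
Proof.
move=> cf; apply: continuousT_comp (@re_continuous R).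
by apply: trace_cts; apply: mulmx_cts => //; exact: trmxC_cts.
Qed.

Lemma nbhs0_sqnorm m n (A : set 'M[C]_(m, n)) :
  nbhs (const_mx 0 : 'M[C]_(m, n)) A ->
  exists2 d : R, 0 < d & forall y, sqnorm y < d -> A y.
Proof.
move=> /nbhs_ballP[e /= e0 eA].
(* The radius is an element of C with 0 < e, hence a real number. *)
have [er er0] : e = toC (re e) /\ 0 < re e.
  have := e0; rewrite ltcE /= => /andP[/eqP i0 r0]; split=> //.
  by rewrite [e in LHS]complexE -[complex.Im e]/(complex.Im e) i0 mulr0 addr0.
exists (re e ^+ 2) => [|y yd]; first by rewrite exprn_gt0.
apply: eA; split=> // i j; rewrite /ball /= mxE sub0r normrN.
rewrite -(@ltr_pXn2r _ 2) // ?nnegrE //; last exact: ltW.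
apply: le_lt_trans (entry_le_sqnorm y i j) _.
by rewrite er -rmorphXn ltcR.
Qed.

End conj_transpose.

(** * Scaling the Cayley transform of a unitary matrix *)

Section cayley.
Local Open Scope sesquilinear_scope.
Variables (R : realType) (n : nat).
Local Notation C := (Cplx R).
Implicit Types (a : R) (x y U : 'M[C]_n).

(** [N] and [M] stand for the numerator and denominator of the Cayley formula, which the adjoint
    exchanges up to a factor [x^t*]. *)
Lemma same_gram (N M : 'M[C]_n) x : N^t* = x^t* *m M -> M^t* = x^t* *m N ->
  comm_mx N M -> N^t* *m N = M^t* *m M.
Proof. by move=> -> -> NM; rewrite -!mulmxA NM. Qed.

Lemma gram_unitary (N M : 'M[C]_n) : M \in unitmx -> N^t* *m N = M^t* *m M ->
  N *m invmx M \is unitarymx.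
Proof.
move=> uM NM; apply/unitarymxP; apply: mulmx1C.
rewrite trmxC_mul -mulmxA (mulmxA (N^t*)) NM -mulmxA mulmxV // mulmx1.
by rewrite -trmxC_mul mulmxV // trmxC_scalar conjC1.
Qed.

(** Moving N^T across J turns it into an adjoint, the equal Gram matrices replace N by M, and M^T
    moves back. *)
Lemma gram_bilinear (N M J : 'M[C]_n) : M \in unitmx -> N^t* *m N = M^t* *m M ->
  N^T *m J = J *m N^t* -> M^T *m J = J *m M^t* ->
  (N *m invmx M)^T *m J *m (N *m invmx M) = J.
Proof.
move=> uM NM NJ MJ.
rewrite trmx_mul -!mulmxA (mulmxA (N^T) J) NJ.
rewrite -(mulmxA J) (mulmxA (N^t*)) NM -(mulmxA (M^t*)) mulmxV // mulmx1.
by rewrite -MJ mulmxA -trmx_mul mulmxV // trmx1 mul1mx.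
Qed.

(** With K = (x - 1)(x + 1)^-1, clearing the factor x + 1 in (1 + (1 - a) K)(1 - (1 - a) K)^-1 gives
    a + (2 - a) x over (2 - a) + a x, which makes sense even where x + 1 is singular. *)
Definition cayley_num a x : 'M[C]_n := (toC a)%:M + toC (2 - a) *: x.
Definition cayley_den a x : 'M[C]_n := (toC (2 - a))%:M + toC a *: x.

(* For unitary x close to 1, the Cayley transform of x is skew-Hermitian, and
   this is the inverse Cayley transform of 1 - a times it. *)
Definition cayley a x : 'M[C]_n := cayley_num a x *m invmx (cayley_den a x).

Lemma comm_mx_inv x y : y \in unitmx -> comm_mx x y -> comm_mx x (invmx y).
Proof.
move=> uy xy; rewrite /comm_mx.
by rewrite -[LHS]mul1mx -(mulVmx uy) -!mulmxA [y *m (_ *m _)]mulmxA -xy mulmxK.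
Qed.

Lemma comm_num a x y : comm_mx y x -> comm_mx y (cayley_num a x).
Proof.
move=> yx; apply: comm_mxD; first exact: comm_mx_scalar.
by rewrite -mul_scalar_mx; apply: comm_mxM => //; exact: comm_mx_scalar.
Qed.

Lemma comm_den a x y : comm_mx y x -> comm_mx y (cayley_den a x).
Proof.
move=> yx; apply: comm_mxD; first exact: comm_mx_scalar.
by rewrite -mul_scalar_mx; apply: comm_mxM => //; exact: comm_mx_scalar.
Qed.

Lemma comm_cayley a x y : cayley_den a x \in unitmx ->
  comm_mx y x -> comm_mx y (cayley a x).
Proof.
move=> ud yx; apply: comm_mxM; first exact: comm_num.
by apply: comm_mx_inv => //; exact: comm_den.
Qed.

Lemma cayley_denE a x : cayley_den a x = 2%:M + toC a *: (x - 1%:M).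
Proof.
rewrite /cayley_den scalerBr scale_scalar_mx mulr1 addrA addrAC -raddfB /=.
by congr (_%:M + _); rewrite /toC rmorphB rmorphMn.
Qed.

Lemma cayley_at0 x : cayley 0 x = x.
Proof.
rewrite /cayley /cayley_num /cayley_den subr0.
have -> : toC 0 = 0 :> C by [].
have -> : toC 2 = 2 :> C by exact: rmorphMn.
by rewrite raddf0 add0r scale0r addr0 -mul_mx_scalar -mulmxA mulmxV ?mulmx1 // unitmxE det_scalar unitfE expf_neq0.
Qed.

Lemma unitmx_scalar2 : (2%:M : 'M[C]_n) \in unitmx.
Proof. by rewrite unitmxE det_scalar unitfE expf_neq0 // pnatr_eq0. Qed.

Lemma cayley_num_id a : cayley_num a 1%:M = cayley_den a 1%:M.
Proof. by rewrite /cayley_num /cayley_den !scale_scalar_mx !mulr1 addrC. Qed.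

Lemma cayley_id a : cayley_den a 1%:M \in unitmx -> cayley a 1%:M = 1%:M.
Proof. by move=> ud; rewrite /cayley cayley_num_id mulmxV. Qed.

Lemma cayley_num_at1 x : cayley_num 1 x = cayley_den 1 x.
Proof. by rewrite /cayley_num /cayley_den; congr ((toC _)%:M + (toC _ *: x)); lra. Qed.

Lemma cayley_at1 x : cayley_den 1 x \in unitmx -> cayley 1 x = 1%:M.
Proof. by move=> ud; rewrite /cayley cayley_num_at1 mulmxV. Qed.

Section unitary.
Variables (a : R) (x : 'M[C]_n).
Hypothesis ux : x \is unitarymx.

Let xV : x *m x^t* = 1%:M. Proof. exact/unitarymxP. Qed.
Let Vx : x^t* *m x = 1%:M. Proof. exact: mulmx1C. Qed.

Lemma trmxC_num : (cayley_num a x)^t* = x^t* *m cayley_den a x.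
Proof.
rewrite /cayley_num /cayley_den trmxCD trmxC_scalar trmxCZ !conj_toC.
by rewrite mulmxDr -scalemxAr Vx mul_mx_scalar scalemx1 addrC.
Qed.

Lemma trmxC_den : (cayley_den a x)^t* = x^t* *m cayley_num a x.
Proof.
rewrite /cayley_num /cayley_den trmxCD trmxC_scalar trmxCZ !conj_toC.
by rewrite mulmxDr -scalemxAr Vx mul_mx_scalar scalemx1 addrC.
Qed.

Lemma num_den_comm : comm_mx (cayley_num a x) (cayley_den a x).
Proof. by apply: comm_den; apply: comm_mx_sym; apply: comm_num. Qed.

Lemma num_den_gram :
  (cayley_num a x)^t* *m cayley_num a x = (cayley_den a x)^t* *m cayley_den a x.
Proof. exact: same_gram trmxC_num trmxC_den num_den_comm. Qed.

Hypothesis ud : cayley_den a x \in unitmx.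

Lemma cayley_unitary : cayley a x \is unitarymx.
Proof. exact: gram_unitary ud num_den_gram. Qed.

(** The relation x^T J = J [x^t*] passes to real combinations of 1 and x, hence to numerator and
    denominator. For J the symplectic form this covers Sp(k). *)
Lemma cayley_bilinear (J : 'M[C]_n) :
  x^T *m J *m x = J -> (cayley a x)^T *m J *m cayley a x = J.
Proof.
move=> xJ.
have xTJ : x^T *m J = J *m x^t* by rewrite -[in RHS]xJ -!mulmxA xV mulmx1.
have aux (b d : R) : ((toC b)%:M + toC d *: x)^T *m J = J *m ((toC b)%:M + toC d *: x)^t*.
  rewrite trmxCD trmxC_scalar trmxCZ !conj_toC linearD /= linearZ /= tr_scalar_mx.
  by rewrite mulmxDl mulmxDr -scalemxAl -scalemxAr xTJ mul_scalar_mx mul_mx_scalar.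
exact: gram_bilinear ud num_den_gram (aux _ _) (aux _ _).
Qed.

Lemma det_num : \det x = 1 -> \det (cayley_num a x) = (\det (cayley_den a x))^*.
Proof.
move=> dx; rewrite -det_trmxC trmxC_den det_mulmx det_trmxC dx conjC1 mul1r //.
Qed.

(** This has modulus 1 but is in general not 1. When the determinant d of the denominator has
    positive real part and r > 0, [phase d] is an r-th root of its inverse. *)
Lemma det_cayley : \det x = 1 ->
  \det (cayley a x) = (\det (cayley_den a x))^* / \det (cayley_den a x).
Proof.
by move=> dx; rewrite /cayley det_mulmx det_inv; congr (_ * _); exact: det_num.
Qed.

End unitary.

Lemma den_conj a x U : U \is unitarymx ->
  cayley_den a (U *m x *m U^t*) = U *m cayley_den a x *m U^t*.
Proof.
move=> /unitarymxP uU; rewrite /cayley_den mulmxDr mulmxDl -scalemxAr -scalemxAl.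
by rewrite mul_mx_scalar -scalemxAl uU scalemx1.
Qed.

Lemma num_conj a x U : U \is unitarymx ->
  cayley_num a (U *m x *m U^t*) = U *m cayley_num a x *m U^t*.
Proof.
move=> /unitarymxP uU; rewrite /cayley_num mulmxDr mulmxDl -scalemxAr -scalemxAl.
by rewrite mul_mx_scalar -scalemxAl uU scalemx1.
Qed.

Lemma det_conj x U : U \is unitarymx -> \det (U *m x *m U^t*) = \det x.
Proof.
move=> /unitarymxP uU; rewrite !det_mulmx mulrAC -det_mulmx uU det1 mul1r //.
Qed.

Lemma cayley_conj a x U : U \is unitarymx -> cayley_den a x \in unitmx ->
  cayley a (U *m x *m U^t*) = U *m cayley a x *m U^t*.
Proof.
move=> uU ud; have /unitarymxP UV := uU; have VU := mulmx1C UV.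
rewrite /cayley num_conj // den_conj //.
have udU : U *m cayley_den a x *m U^t* \in unitmx by rewrite unitmxE det_conj // -unitmxE.
have -> : invmx (U *m cayley_den a x *m U^t*) = U *m invmx (cayley_den a x) *m U^t*.
  rewrite -[LHS]mulmx1 -[in LHS]UV -[X in _ *m (X *m _)]mulmx1 -(mulmxV ud).
  rewrite -[X in _ *m (U *m (X *m _) *m _)]mulmx1 -VU.
  by rewrite !mulmxA -(mulmxA (invmx _)) -(mulmxA (invmx _)) mulVmx // mul1mx.
by rewrite !mulmxA -(mulmxA _ (U^t*) U) VU mulmx1.
Qed.

End cayley.

Section retraction.
Local Open Scope sesquilinear_scope.
Variables (R : realType) (c : classical_group).
Local Notation C := (Cplx R).
Local Notation n := (cg_dim c).
Implicit Types (a : R) (x y U : 'M[C]_n).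

(* The Cayley transform does not preserve SU(r): the determinant is corrected
   by an r-th root, which is a central factor. *)
Definition phase (m : C) : C :=
  if c is SpecialUnitary r then cis (arg m *+ 2 / r%:R) else 1.

Definition retract a x : 'M[C]_n :=
  phase (\det (cayley_den a x)) *: cayley a x.

Lemma phase_unit m : phase m * (phase m)^* = 1.
Proof. by rewrite /phase; case: c => [r|r|k]; rewrite ?cis_unit // conjC1 mulr1. Qed.

Lemma phase_real m : im m = 0 -> phase m = 1.
Proof.
by rewrite /phase => m0; case: c => // r; rewrite arg_real // mul0rn mul0r cis0.
Qed.

Lemma phase_cts (Z : topologicalType) (f : Z -> C) :
  (forall z, 0 < re (f z)) -> continuous f -> continuous (fun z => phase (f z)).
Proof.
move=> f0 cf; rewrite /phase; case: c => [r|r|k]; [|exact: cst_continuous..].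
apply: continuousT_comp (@cis_continuous R).
have carg : continuous (fun z => arg (f z)).
  apply: (@continuousT_comp _ _ _ (fun z => im (f z) / re (f z)) atan).
    apply: mulK_cts; first by apply: continuousT_comp cf (@im_continuous R).
    apply: invK_cts; first by move=> z; rewrite gt_eqF.
    by apply: continuousT_comp cf (@re_continuous R).
  by move=> z; exact: continuous_atan.
apply: mulK_cts; last exact: cst_continuous.
by apply: addK_cts.
Qed.

Lemma im_det2 : im (\det (2%:M : 'M[C]_n)) = 0.
Proof.
rewrite det_scalar; have -> : (2 : C) = toC 2 by rewrite [RHS]rmorphMn.
by rewrite -[toC 2 ^+ _](rmorphXn (real_complex R)).
Qed.

Lemma re_gt0_unit x : 0 < re (\det x) -> x \in unitmx.
Proof.
move=> h; rewrite unitmxE unitfE; apply: contraTneq h => ->.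
by rewrite ltxx.
Qed.

Lemma retract_in a x : cg_set R c x -> 0 < re (\det (cayley_den a x)) ->
  cg_set R c (retract a x).
Proof.
move=> xc dx; have ux := cg_unitary xc; have ud := re_gt0_unit dx.
have ru : retract a x \is unitarymx.
  apply/unitarymxP; rewrite /retract trmxCZ -scalemxAl -scalemxAr scalerA.
  by rewrite phase_unit scale1r; apply/unitarymxP; exact: cayley_unitary.
have det0 : \det (cayley_den a x) != 0 by rewrite -unitfE -unitmxE.
move: x xc dx ux ud ru det0; rewrite /retract /phase.
case: c => [r|r|k] /= x xc dx ux ud ru det0 //.
- split=> //; rewrite detZ.
  (* For r = 0 there is no root to take, but the empty determinant is 1. *)
  case: r x xc dx ux ud ru det0 => [|r] x xc dx ux ud ru det0.
    by rewrite det_mx00 mulr1.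
  rewrite cisX -[X in cis X]mulr_natr divfK ?pnatr_eq0 //.
  rewrite (det_cayley a ux (proj2 xc)) mulrA.
  by rewrite cis_argM2 // mulfV.
- split; first exact: ru.
  by rewrite scale1r; exact: (cayley_bilinear ux ud (proj2 xc)).
Qed.

Lemma retract_at0 x : retract 0 x = x.
Proof.
rewrite /retract cayley_at0 phase_real ?scale1r //.
have -> : cayley_den 0 x = 2%:M; last exact: im_det2.
by rewrite cayley_denE scale0r addr0.
Qed.

Lemma den_at1 a : cayley_den a (1%:M : 'M[C]_n) = 2%:M.
Proof. by rewrite cayley_denE subrr scaler0 addr0. Qed.

Lemma retract_id a : retract a 1%:M = 1%:M.
Proof.
rewrite /retract cayley_id den_at1; last exact: unitmx_scalar2.
by rewrite phase_real ?scale1r //; exact: im_det2.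
Qed.

(** At a = 1 numerator and denominator coincide; for SU(r), [det_num] then makes the determinant of
    the denominator real, so the phase is 1. *)
Lemma retract_at1 x : cg_set R c x -> 0 < re (\det (cayley_den 1 x)) ->
  retract 1 x = 1%:M.
Proof.
move=> xc dx; have ud := re_gt0_unit dx.
rewrite /retract cayley_at1 //.
have -> : phase (\det (cayley_den 1 x)) = 1; last by rewrite scale1r.
move: x xc dx ud; rewrite /phase; case: c => //= r x [ux detx] dx ud.
have : im (\det (cayley_den 1 x)) = - im (\det (cayley_den 1 x)).
  by rewrite -im_conj -(det_num _ ux detx) cayley_num_at1.
move=> h; rewrite arg_real ?mul0rn ?mul0r ?cis0 //; lra.
Qed.

Lemma retract_conj a x U : U \is unitarymx -> cayley_den a x \in unitmx ->
  retract a (U *m x *m U^t*) = U *m retract a x *m U^t*.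
Proof.
move=> uU ud; rewrite /retract den_conj // det_conj // cayley_conj //.
by rewrite -scalemxAr -scalemxAl.
Qed.

Lemma comm_retract a x y : cayley_den a x \in unitmx ->
  comm_mx y x -> comm_mx y (retract a x).
Proof.
move=> ud yx; rewrite /retract -mul_scalar_mx.
by apply: comm_mxM; [exact: comm_mx_scalar|exact: comm_cayley].
Qed.

Lemma retract_cts (Z : topologicalType) (a : Z -> R) (f : Z -> 'M[C]_n) :
  (forall z, 0 < re (\det (cayley_den (a z) (f z)))) ->
  continuous a -> continuous f -> continuous (fun z => retract (a z) (f z)).
Proof.
move=> h ca cf.
have cC (b : Z -> R) : continuous b -> continuous (fun z => toC (b z)).
  by move=> cb; apply: continuousT_comp cb (@toC_continuous R).
have ca2 : continuous (fun z => 2 - a z) by cts.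
have csc (b : Z -> R) : continuous b -> continuous (fun z => (toC (b z))%:M : 'M[C]_n).
  move=> cb; have -> : (fun z => (toC (b z))%:M : 'M[C]_n) = fun z => toC (b z) *: 1%:M.
    by apply/funext => z; rewrite scalemx1.
  by apply: scalemx_cts; [exact: cC|exact: cst_continuous].
have cden : continuous (fun z => cayley_den (a z) (f z)).
  exact: (addmx_cts (csc _ ca2) (scalemx_cts (cC _ ca) cf)).
apply: scalemx_cts; first by apply: phase_cts h _; exact: det_cts.
apply: mulmx_cts.
  exact: (addmx_cts (csc _ ca) (scalemx_cts (cC _ ca2) cf)).
apply: invmx_cts cden => z.
by have := re_gt0_unit (h z); rewrite unitmxE unitfE.
Qed.

End retraction.

(* The clauses on commuting and on order let [h] act coordinatewise on spaces
   of homomorphisms, compatibly with replacing a coordinate by 1. *)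
Record contraction (R : realType) (G : topGroupType) (q : int) (h : G * R -> G)
    (u : G -> R) : Prop := Contraction {
  ct_continuous : continuous h;
  ct_h0 : forall x, h (x, 0) = x;
  ct_ht1 : forall t, h (1%g, t) = 1%g;
  ct_conj : forall g x t, h ((g * x * g^-1)%g, t) = (g * h (x, t) * g^-1)%g;
  ct_commute : forall x y t, commute y x -> commute y (h (x, t));
  ct_order : forall x t, expgz x q = 1%g -> expgz (h (x, t)) q = 1%g;
  ct_u_continuous : continuous u;
  ct_u_conj : forall g x, u (g * x * g^-1)%g = u x;
  ct_u_ge0 : forall x, 0 <= u x;
  ct_u1 : u 1%g = 0;
  ct_u_lt1 : forall x, u x < 1 -> h (x, 1) = 1%g
}.

Lemma expgz_eq1 (G : topGroupType) (x : G) (q : int) :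
  expgz x q = 1%g <-> (x ^+ absz q)%g = 1%g.
Proof.
case: q => m //=; split=> [e|->]; last by rewrite invg1.
by rewrite -[LHS]invgK e invg1.
Qed.

Section classical_contraction.
Local Open Scope sesquilinear_scope.
Variables (R : realType) (c : classical_group) (q : int).
Local Notation C := (Cplx R).
Local Notation n := (cg_dim c).

Lemma cg_valX (x : cg R c) k : \val (x ^+ k)%g = (\val x : 'M[C]_n) ^+ k.
Proof. by elim: k => [|k IH] //; rewrite expgS exprS -IH. Qed.

(** Both conditions are open and hold at y = 0, where the determinants are 2^n and |q|^n. The first
    makes the denominator invertible and its argument continuous. The second excludes torsion near
    1, since x^|q| - 1 is x - 1 times the sum, for x = 1 + y. *)
Lemma contraction_radius : exists2 d : R, 0 < d & forall y : 'M[C]_n, sqnorm y < d ->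
  0 < re (\det (2%:M + y)) /\
  ((0 < absz q)%N -> \det (\sum_(i < absz q) (1%:M + y) ^+ i) != 0).
Proof.
have idc : continuous (fun y : 'M[C]_n => y) by exact: continuousT_id.
have c2 : continuous (fun y : 'M[C]_n => re (\det (2%:M + y))).
  apply: continuousT_comp (@re_continuous R); apply: det_cts.
  by apply: addmx_cts idc; exact: cst_continuous.
have cs : continuous (fun y : 'M[C]_n => \det (\sum_(i < absz q) (1%:M + y) ^+ i)).
  apply: det_cts; apply: summx_cts => i; apply: expmx_cts.
  by apply: addmx_cts idc; exact: cst_continuous.
apply: nbhs0_sqnorm; apply: filterI.
- apply: (cvgr_gt _ (c2 (const_mx 0))).
  rewrite (addr0 (2%:M : 'M[C]_n)) det_scalar.
  have -> : (2 : C) = toC 2 by rewrite [RHS]rmorphMn.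
  by rewrite -[toC 2 ^+ _](rmorphXn (real_complex R)) /re /= exprn_gt0.
- have [q0|q0] := posnP (absz q); first by apply: filterE => y.
  have : \forall y \near (const_mx 0 : 'M[C]_n),
      \det (\sum_(i < absz q) (1%:M + y) ^+ i) != 0.
    apply: (cvgr_neq0 _ (cs (const_mx 0))); rewrite (addr0 (1 : 'M[C]_n)).
    under eq_bigr => i _ do rewrite expr1n.
    rewrite sumr_const card_ord -[1%R]/(1%:M : 'M[C]_n) -raddfMn det_scalar expf_neq0 //.
    by rewrite pnatr_eq0 -lt0n.
  by apply: filterS => y.
Qed.

Lemma cg_contraction : exists (h : cg R c * R -> cg R c) u, contraction q h u.
Proof.
have [d d0 dP] := contraction_radius.
pose s (x : cg R c) := sqnorm (\val x - 1%:M).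
(* The factor 3 puts the set u < 2 inside s < 2d/3, within the radius d. *)
pose u (x : cg R c) := 3 * s x / d.
(* Equal to 1 for u <= 1 and to 0 for u >= 2: points with u < 1 are fully contracted, and points
   with u >= 2 do not move. *)
pose kap x := Num.max 0 (Num.min 1 (2 - u x)).
pose a (v : cg R c * R) := clamp v.2 * kap v.1.
have kap01 x : 0 <= kap x <= 1.
  by rewrite /kap le_max lexx ge_max ler01 ge_min lexx.
have a01 v : 0 <= a v <= 1.
  have /andP[k0 k1] := kap01 v.1.
  have := clamp_in v.2; rewrite inE /= in_itv /= => /andP[c0 c1].
  by rewrite /a mulr_ge0 //= mulr_ile1.
have s_u x : s x = u x * d / 3 by rewrite /u; field; rewrite gt_eqF.
have s_lt x : u x < 2 -> s x < d by rewrite s_u; nra.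
have a_u v : 2 <= u v.1 -> a v = 0.
  by move=> u2; rewrite /a /kap max_l ?mulr0 // ge_min; apply/orP; right; lra.
(* Either a = 0, or u < 2 and the factor a <= 1 only shrinks x - 1; so the denominator is invertible
   for every x, not only near 1. *)
have good v : sqnorm (toC (a v) *: (\val v.1 - 1%:M)) < d.
  rewrite sqnormZ -/(s v.1); have [u2|u2] := ltP (u v.1) 2; last first.
    by rewrite a_u // expr0n mul0r.
  apply: le_lt_trans (s_lt _ u2).
  have /andP[a0 a1] := a01 v; have s0 : 0 <= s v.1 by exact: sqnorm_ge0.
  by rewrite ler_piMl // exprn_ile1.
have dn v : 0 < re (\det (cayley_den (a v) (\val v.1))).
  by rewrite cayley_denE; exact: (dP _ (good v)).1.
pose h (v : cg R c * R) : cg R c :=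
  exist _ (@retract R c (a v) (\val v.1)) (mem_set (retract_in (set_valP v.1) (dn v))).
have valM (x y : cg R c) : \val (x * y)%g = \val x *m \val y by [].
have valV (x : cg R c) : \val (x^-1)%g = (\val x)^t* by [].
have uval (x : cg R c) : (\val x : 'M[C]_n) \is unitarymx by exact: cg_unitary (set_valP x).
have conjB (g x : cg R c) : (\val (g * x * g^-1)%g : 'M[C]_n) - 1%:M =
    \val g *m (\val x - 1%:M) *m (\val g)^t*.
  rewrite mulmxBr mulmxBl mulmx1; congr (_ - _).
  by apply/esym/unitarymxP; exact: uval.
have su g x : u (g * x * g^-1)%g = u x.
  by rewrite /u /s conjB sqnorm_conj.
have cval : continuous (fun x : cg R c => \val x : 'M[C]_n) by exact: continuous_val.
have cu : continuous u.
  apply: mul_cts; last exact: cst_continuous.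
  apply: mul_cts; first exact: cst_continuous.
  apply: sqnorm_cts; apply: addmx_cts; [exact: cval|exact: cst_continuous].
have ca : continuous a.
  apply: mul_cts; first by apply: continuousT_comp (@snd_cts _ _) (@clamp_continuous R).
  apply: (@continuousT_comp _ _ _ fst kap); first exact: fst_cts.
  by apply: max_cts; [|apply: min_cts; [|apply: add_cts; [|exact: opp_cts]]];
    exact: cst_continuous.
exists h, u; split=> //.
- apply: (@continuous_set_type _ _ (cg_set R c) h).
  apply: retract_cts => //.
  by apply: (@continuousT_comp _ _ _ fst (fun x : cg R c => \val x));
    [exact: fst_cts|exact: cval].
- by move=> x; apply/val_inj; rewrite /= /a clamp_le0 // mul0r retract_at0.
- by move=> t; apply/val_inj; rewrite /= retract_id.
- move=> g x t; apply/val_inj; rewrite valM valM valV /=.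
  have -> : a ((g * x * g^-1)%g, t) = a (x, t) by rewrite /a /kap su.
  apply: retract_conj; first exact: (uval g).
  exact: (@re_gt0_unit R c _ (dn (x, t))).
- move=> x y t yx; apply/val_inj; rewrite !valM /=.
  apply: comm_retract; first exact: (@re_gt0_unit R c _ (dn (x, t))).
  by have /(congr1 val) := yx.
(* Points with u >= 2 stay in place; for q <> 0 the only solution of x^q = 1 with u < 2 is 1, which
   is fixed. *)
- move=> x t; rewrite !expgz_eq1 => xq; have [u2|u2] := ltP (u x) 2; last first.
    have -> : h (x, t) = x by apply/val_inj; rewrite /= a_u // retract_at0.
    exact: xq.
  have [q0|q0] := posnP (absz q); first by rewrite q0.
  suff -> : x = 1%g.
    have -> : h (1%g, t) = 1%g by apply/val_inj; rewrite /= retract_id.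
    by rewrite expg1n.
  have [_ /(_ q0)] := dP _ (s_lt _ u2).
  have -> : 1%:M + (\val x - 1%:M) = \val x by rewrite addrC subrK.
  rewrite -unitfE -unitmxE => su1.
  have xS : (\val x - 1%:M : 'M[C]_n) *m \sum_(i < absz q) (\val x : 'M[C]_n) ^+ i = 0.
    rewrite -[LHS]/((\val x - 1) * _) -subrX1 -cg_valX xq.
    exact: subrr.
  apply/val_inj/eqP; rewrite -subr_eq0; apply/eqP.
  have := mulmxK su1 (\val x - 1%:M : 'M[C]_n); rewrite xS mul0mx.
  exact: esym.
- by move=> x; rewrite /u divr_ge0 ?mulr_ge0 ?sqnorm_ge0 // ltW.
- by rewrite /u /s [X in sqnorm X]subrr sqnorm0 mulr0 mul0r.
- move=> x u1; apply/val_inj => /=.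
  have a1 : a (x, 1) = 1.
    rewrite /a /= clamp_ge1 // mul1r /kap min_l ?max_r ?ler01 //; lra.
  have := dn (x, 1); rewrite a1 /= => dx; exact: retract_at1 (set_valP x) dx.
Qed.

End classical_contraction.

(** Everything is coordinatewise except u, which is a sum: its terms are nonnegative, so u < 1 makes
    each of them < 1. *)
Lemma cg_prod_contraction (R : realType) (k : nat) (c : 'I_k -> classical_group)
    (q : int) :
  exists (h : cg_prod R c * R -> cg_prod R c) u, contraction q h u.
Proof.
have /(_ _)/cid-/all_sig[H HP] := fun l => @cg_contraction R (c l) q.
have {HP} /(_ _)/cid-/all_sig[U P] := HP.
have coord l : continuous (fun x : cg_prod R c => x l).
  exact: (@proj_continuous _ (fun l => cg R (c l))).
have prodX (x : cg_prod R c) m l : (x ^+ m)%g l = (x l ^+ m)%g.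
  by elim: m => [|m IH] //; rewrite !expgS -IH.
have commP (x y : cg_prod R c) : commute y x <-> forall l, commute (y l) (x l).
  split=> [yx l|yx]; first by have := congr1 (fun f => f l) yx.
  by apply: functional_extensionality_dep => l; exact: yx.
have expP (x : cg_prod R c) : expgz x q = 1%g <-> forall l, expgz (x l) q = 1%g.
  rewrite expgz_eq1; split=> [e l|e]; first by rewrite expgz_eq1 -prodX e.
  by apply: functional_extensionality_dep => l; rewrite prodX; apply/expgz_eq1.
pose h (v : cg_prod R c * R) : cg_prod R c := fun l => H l (v.1 l, v.2).
pose u (x : cg_prod R c) := \sum_l U l (x l).
have u0 l (x : cg_prod R c) : 0 <= U l (x l) by exact: ct_u_ge0 (P l) _.
exists h, u; split=> [|x|t|g x t|x y t|x t||g x|x||x u1].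
- apply: (@continuous_ptws _ (fun l => cg R (c l))) => l.
  apply: (continuousT_comp (g := H l)); last exact: ct_continuous (P l).
  apply: continuous_pair; last exact: snd_cts.
  by apply: (@continuousT_comp _ _ _ fst (fun x : cg_prod R c => x l));
    [exact: fst_cts|exact: coord].
- by apply: functional_extensionality_dep => l; exact: (ct_h0 (P l)).
- by apply: functional_extensionality_dep => l; exact: (ct_ht1 (P l)).
- by apply: functional_extensionality_dep => l; exact: (ct_conj (P l)).
- by move=> /commP yx; apply/commP => l; exact: (ct_commute (P l) t (yx l)).
- by move=> /expP xq; apply/expP => l; exact: (ct_order (P l) t (xq l)).
- apply: sum_cts => l; apply: (continuousT_comp (g := U l)); first exact: coord.
  exact: ct_u_continuous (P l).
- by apply: eq_bigr => l _; exact: (ct_u_conj (P l)).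
- by apply: sumr_ge0 => l _.
- by apply: big1 => l _; exact: (ct_u1 (P l)).
- apply: functional_extensionality_dep => l; apply: (ct_u_lt1 (P l)).
  apply: le_lt_trans u1; rewrite /u (bigD1 l) //= lerDl.
  by apply: sumr_ge0 => l' _.
Qed.

(** * Spaces of homomorphisms *)

Section hom_splitting.
Variables (R : realType) (G : topGroupType) (n : nat) (q : 'I_n -> int).
Variables (H : forall i : 'I_n, G * R -> G) (U : forall i : 'I_n, G -> R).
Hypothesis HU : forall i, contraction (q i) (H i) (U i).

Local Notation X := (hom_space G q).

Lemma hom_coord_cts r (p : 'I_r -> int) (i : 'I_r) :
  continuous (fun x : hom_space G p => \val x i : G).
Proof.
apply: (@continuousT_comp _ {ptws 'I_r -> G} _ (fun x : hom_space G p => \val x)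
  (fun f => f i)); first exact: continuous_val.
exact: (@proj_continuous _ (fun _ : 'I_r => G)).
Qed.

Lemma hom_cts (Z : topologicalType) r (p : 'I_r -> int) (f : Z -> hom_space G p) :
  (forall i, continuous (fun z => \val (f z) i : G)) -> continuous f.
Proof.
move=> cf; apply: (@continuous_set_type _ _ (hom_set p) f).
exact: (@continuous_ptws _ (fun _ : 'I_r => G)).
Qed.

Lemma hom_eq r (p : 'I_r -> int) (x y : hom_space G p) :
  (forall i, \val x i = \val y i) -> x = y.
Proof. by move=> xy; apply/val_inj/funext. Qed.

Lemma expgz1 (z : int) : expgz (1%g : G) z = 1%g.
Proof. by apply/expgz_eq1; rewrite expg1n. Qed.

Definition erase_fun (k : nat) (x : X) : {ptws 'I_n -> G} :=
  fun j => if j == k :> nat then 1%g else \val x j.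

Fact erase_subproof k x : hom_set q (erase_fun k x).
Proof.
have [xC xq] := set_valP x; split=> [i j|i]; rewrite /erase_fun.
  by case: ifP => _; case: ifP => _ //; rewrite /commute ?mulg1 ?mul1g //; exact: xC.
by case: ifP => _; [exact: expgz1|exact: xq].
Qed.

Definition erase k (x : X) : X := exist _ (erase_fun k x) (mem_set (erase_subproof k x)).

Lemma eraseE k x j : \val (erase k x) j = if j == k :> nat then 1%g else \val x j.
Proof. by []. Qed.

Definition deform_fun (v : X * R) : {ptws 'I_n -> G} := fun j => H j (\val v.1 j, v.2).

Fact deform_subproof v : hom_set q (deform_fun v).
Proof.
have [xC xq] := set_valP v.1; split=> [i j|i]; rewrite /deform_fun.
  apply: (ct_commute (HU j)); apply: commute_sym.
  by apply: (ct_commute (HU i)); exact: xC.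
exact: (ct_order (HU i)).
Qed.

Definition deform (v : X * R) : X :=
  exist _ (deform_fun v) (mem_set (deform_subproof v)).

Lemma deformE v j : \val (deform v) j = H j (\val v.1 j, v.2).
Proof. by []. Qed.

Lemma hom_actE r (p : 'I_r -> int) g (x : hom_space G p) j :
  \val (bg_act (hom_space G p) g x) j = (g * \val x j * g^-1)%g.
Proof. by []. Qed.

Lemma hom_ptE r (p : 'I_r -> int) j : \val (bg_pt (hom_space G p)) j = 1%g.
Proof. by []. Qed.

(** The sum has one term for k < n, and none for k >= n, where [erase k] is the identity. *)
Definition distance (k : nat) (x : X) : R := \sum_(j < n | j == k :> nat) U j (\val x j).

Lemma hom_split_data : split_data erase deform distance.
Proof.
split=> [k|k x|k l x||t|x|k x t|k|k g x|k x|k x|k x].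
- split=> [|g x|].
  + apply: hom_cts => i.
    have [e|e] := boolP (i == k :> nat).
      have -> : (fun x => \val (erase k x) i) = fun _ => 1%g.
        by apply/funext => x; rewrite eraseE e.
      exact: cst_continuous.
    have -> : (fun x => \val (erase k x) i) = fun x => \val x i.
      by apply/funext => x; rewrite eraseE (negbTE e).
    exact: hom_coord_cts.
  + apply: hom_eq => i; rewrite hom_actE !eraseE.
    by case: ifP => // _; rewrite mulg1 mulgV.
  + by apply: hom_eq => i; rewrite eraseE hom_ptE; case: ifP.
- by apply: hom_eq => i; rewrite !eraseE; case: (i == k :> nat).
- by apply: hom_eq => i; rewrite !eraseE; case: (i == k :> nat); case: (i == l :> nat).
- apply: hom_cts => i; apply: (continuousT_comp (g := H i));
    last exact: ct_continuous (HU i).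
  apply: continuous_pair; last exact: snd_cts.
  by apply: (@continuousT_comp _ _ _ fst (fun x : X => \val x i));
    [exact: fst_cts|exact: hom_coord_cts].
- split=> [|g x|].
  + apply: hom_cts => i; apply: (continuousT_comp (g := H i));
      last exact: ct_continuous (HU i).
    by apply: continuous_pair; [exact: hom_coord_cts|exact: cst_continuous].
  + by apply: hom_eq => i; rewrite hom_actE !deformE; exact: (ct_conj (HU i)).
  + by apply: hom_eq => i; rewrite deformE hom_ptE; exact: (ct_ht1 (HU i)).
- by apply: hom_eq => i; rewrite deformE; exact: (ct_h0 (HU i)).
- apply: hom_eq => i; rewrite !(eraseE, deformE) /=.
  by case: ifP => // _; exact: (ct_ht1 (HU i)).
- apply: sum_cts => i; apply: (continuousT_comp (g := U i)); first exact: hom_coord_cts.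
  exact: ct_u_continuous (HU i).
- by apply: eq_bigr => i _; exact: (ct_u_conj (HU i)).
- by apply: sumr_ge0 => i _; exact: (ct_u_ge0 (HU i)).
- by apply: big1 => i ik; rewrite eraseE ik; exact: (ct_u1 (HU i)).
- move=> u1; apply: hom_eq => i; rewrite eraseE; case: ifP => // ik.
  rewrite deformE; apply/esym/(ct_u_lt1 (HU i)); apply: le_lt_trans u1.
  rewrite /distance (bigD1 i) //= lerDl.
  by apply: sumr_ge0 => j _; exact: (ct_u_ge0 (HU j)).
Qed.

Lemma erase_seq (s : seq nat) x j :
  \val (foldr erase x s) j = if (j : nat) \in s then 1%g else \val x j.
Proof.
elim: s => [|k s IH] //.
rewrite -[foldr _ _ _]/(erase k (foldr erase x s)) eraseE IH inE.
by case: (j == k :> nat).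
Qed.

Lemma respects_erase_seq (Z : bgspace G) (b : nat -> bool) (f : X -> Z) (s : seq nat) x :
  respects n b erase f -> {in s, forall k, (k < n)%N && ~~ b k} ->
  f (foldr erase x s) = f x.
Proof.
move=> fe; elim: s => [|k s IH] //= sP.
have /andP[kn /negbTE kb] : (k < n)%N && ~~ b k by apply: sP; rewrite inE eqxx.
by rewrite fe // kb IH // => l ls; apply: sP; rewrite inE ls orbT.
Qed.

Section summand.
Variables (r : nat) (m : Jset n r.+1).
Local Notation mm := (val m).
Local Notation P := (Porders q m).
Local Notation pi := (qpi (@S1_act G r.+1 P)).

Definition in_Jset (k : nat) : bool := k \in map val mm.

Lemma Jset_inj : injective (tnth mm).
Proof.
apply/tuple_uniqP/(@map_uniq _ _ val).
exact: (sorted_uniq ltn_trans ltnn (valP m)).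
Qed.

Lemma in_Jset_tnth j : in_Jset (tnth mm j).
Proof. by apply/mapP; exists (tnth mm j) => //; exact: mem_tnth. Qed.

Lemma in_JsetP (i : 'I_n) : reflect (exists j, tnth mm j = i) (in_Jset i).
Proof.
apply: (iffP idP) => [|[j <-]]; last exact: in_Jset_tnth.
by move=> /mapP[i' /tnthP[j ->] /val_inj ->]; exists j.
Qed.

Definition restrict_fun (x : X) : {ptws 'I_r.+1 -> G} := fun j => \val x (tnth mm j).

Fact restrict_subproof (x : X) : hom_set P (restrict_fun x).
Proof.
have [xC xq] := set_valP x; split=> [i j|i]; first exact: xC.
exact: xq.
Qed.

Definition restrict (x : X) : hom_space G P := 
  exist _ (restrict_fun x) (mem_set (restrict_subproof x)).

Lemma restrictE x j : \val (restrict x) j = \val x (tnth mm j).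
Proof. by []. Qed.

(** A section of [restrict], with image the common image of the [erase k] for k outside m; this
    identifies Hom(P_m(pi), G) with that subspace. *)
Definition extend_fun (y : hom_space G P) : {ptws 'I_n -> G} :=
  fun i => if [pick j | tnth mm j == i] is Some j then \val y j else 1%g.

Fact extend_subproof y : hom_set q (extend_fun y).
Proof.
have [yC yq] := set_valP y; split=> [i j|i]; rewrite /extend_fun.
  case: pickP => [i' _|_]; case: pickP => [j' _|_]; rewrite /commute ?mulg1 ?mul1g //.
  exact: yC.
by case: pickP => [j /eqP <-|_]; [exact: yq|exact: expgz1].
Qed.

Definition extend (y : hom_space G P) : X :=
  exist _ (extend_fun y) (mem_set (extend_subproof y)).

Lemma extend_in y j : \val (extend y) (tnth mm j) = \val y j.
Proof.
rewrite /= /extend_fun; case: pickP => [j' /eqP/Jset_inj -> //|/(_ j)].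
by rewrite eqxx.
Qed.

Lemma extend_out y (i : 'I_n) : ~~ in_Jset i -> \val (extend y) i = 1%g.
Proof.
move=> /in_JsetP im; rewrite /= /extend_fun; case: pickP => [j /eqP ji|//].
by case: im; exists j.
Qed.

Lemma restrict_bgmap : bgmap restrict.
Proof.
split=> [|g x|].
- by apply: hom_cts => j; exact: hom_coord_cts.
- exact: hom_eq.
- exact: hom_eq.
Qed.

Lemma extend_bgmap : bgmap extend.
Proof.
split=> [|g y|].
- apply: hom_cts => i; have [/in_JsetP[j <-]|im] := boolP (in_Jset i).
    have -> : (fun y => \val (extend y) (tnth mm j)) = fun y => \val y j.
      by apply/funext => y; rewrite extend_in.
    exact: hom_coord_cts.
  have -> : (fun y => \val (extend y) i) = fun=> 1%g.
    by apply/funext => y; rewrite extend_out.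
  exact: cst_continuous.
- apply: hom_eq => i; rewrite hom_actE; have [/in_JsetP[j <-]|im] := boolP (in_Jset i).
    by rewrite !extend_in.
  by rewrite !extend_out // mulg1 mulgV.
- apply: hom_eq => i; have [/in_JsetP[j <-]|im] := boolP (in_Jset i).
    by rewrite extend_in.
  by rewrite extend_out.
Qed.

Lemma extendK y : restrict (extend y) = y.
Proof. by apply: hom_eq => j; rewrite restrictE extend_in. Qed.

Lemma restrictK x :
  extend (restrict x) = foldr erase x [seq k <- iota 0 n | ~~ in_Jset k].
Proof.
apply: hom_eq => i; rewrite erase_seq mem_filter mem_iota leq0n ltn_ord !andbT.
 have [/in_JsetP[j <-]|im] := boolP (in_Jset i); first by rewrite extend_in.
by rewrite extend_out.
Qed.

(** A respecting f does not see the coordinates outside m, so it is determined by its composite with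
    [extend]. If y_j = 1, then [extend y] is fixed by the erasure of m_j, whose image f sends to the
    base point; so the composite descends modulo S_1. *)
Lemma hom_summand : is_summand n in_Jset erase (fun x => pi (restrict x)).
Proof.
(* The rank r.+1 is positive; in rank 0 the set [S1] would be empty and miss the base point. *)
have S1pt : S1 (bg_pt (hom_space G P)) by exists ord0.
have pm := qpi_bgmap (@S1_act G r.+1 P).
have piS1 y : S1 y -> pi y = bg_pt (hom_mod_S1 G P).
  by move=> Sy; rewrite -(bgmap_pt pm); exact: qpi_eq.
split=> [|w|k kn x|Z f fm fe].
- exact: bgmap_comp restrict_bgmap pm.
- by have [y ->] := qpi_surj w; exists (extend y); rewrite extendK.
- case: ifP => km; last first.
    congr (pi _); apply: hom_eq => j; rewrite !restrictE eraseE; case: ifP => // /eqP jk.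
    by have := in_Jset_tnth j; rewrite jk km.
  have /in_JsetP[j jk] : in_Jset (Ordinal kn) by [].
  by apply: piS1; exists j; rewrite restrictE eraseE jk eqxx.
- have fS1 y : S1 y -> f (extend y) = bg_pt Z.
    move=> [j yj]; have := fe (tnth mm j) (ltn_ord _) (extend y); rewrite in_Jset_tnth => <-.
    congr f; apply: hom_eq => i; rewrite eraseE; case: ifP => // /eqP/val_inj ->.
    by rewrite extend_in.
  exists (qlift (A_act := @S1_act G r.+1 P) (fun y => f (extend y))).
    apply: qlift_bgmap => //; exact: bgmap_comp extend_bgmap fm.
  move=> x; rewrite qliftE => [|y z Sy Sz]; last by rewrite !fS1.
  rewrite restrictK (respects_erase_seq x fe) // => k.
  by rewrite mem_filter mem_iota => /andP[-> /= ->].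
Qed.

End summand.

Local Notation K := {r : 'I_n & Jset n r.+1}.

Lemma in_Jset_inj (s s' : K) :
  (forall k, (k < n)%N -> in_Jset (tagged s) k = in_Jset (tagged s') k) -> s = s'.
Proof.
move: s s' => [r m] [r' m'] /= mm'.
have e : map val (val m) = map val (val m').
  apply: (irr_sorted_eq ltn_trans ltnn); [exact: valP m|exact: valP m'|].
  move=> k; have [kn|kn] := ltnP k n; first exact: mm'.
  have out r0 (m0 : Jset n r0) : (k \in map val (val m0)) = false.
    by apply/negP => /mapP[i _ ki]; have := ltn_ord i; rewrite -ki ltnNge kn.
  by rewrite !out.
have {}e : val m = val m' :> seq 'I_n by exact: (inj_map val_inj).
have rr' : r = r'.
  by apply/val_inj; have := congr1 size e; rewrite !size_tuple => -[].
subst r'; congr (Tagged _ _).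
by apply/val_inj/val_inj.
Qed.

(** Listing the k < n with [b k] in increasing order gives the index, of rank at least 1. Only the
    empty list has no index. *)
Lemma in_Jset_surj (b : nat -> bool) :
  (exists s : K, forall k, (k < n)%N -> in_Jset (tagged s) k = b k) \/
  (forall k, (k < n)%N -> b k = false).
Proof.
pose s : seq 'I_n := [seq i <- enum 'I_n | b (val i)].
have es : map val s = [seq k <- iota 0 n | b k].
  by rewrite -val_enum_ord filter_map.
case sr : (size s) => [|r].
  right=> k kn; apply/negbTE/negP => bk.
  have : k \in map val s by rewrite es mem_filter bk mem_iota.
  by rewrite (size0nil sr).
left.
have rn : (r < n)%N by rewrite -sr size_filter -[leqRHS](size_enum_ord n) count_size.
have st : size s == (Ordinal rn).+1 by rewrite sr.
have ss : sorted ltn (map val (Tuple st)).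
  by rewrite /= es; apply: (sorted_filter ltn_trans); exact: iota_ltn_sorted.
exists (Tagged (fun r : 'I_n => Jset n r.+1) (exist _ (Tuple st) ss : Jset n (Ordinal rn).+1)).
by move=> k kn; rewrite /in_Jset /= es mem_filter mem_iota /= kn andbT.
Qed.

Theorem hom_splitting :
  bgheq R (susp R X) (bigwedge (fun r : 'I_n =>
    susp R (bigwedge (fun m : Jset n r.+1 => hom_mod_S1 G (Porders q m))))).
Proof.
apply: bgheq_trans.
  apply: (iterated_splitting (n := n) (I := K) (b := fun s => in_Jset (tagged s))
    (Q := fun s => hom_mod_S1 G (Porders q (tagged s)))
    (p := fun s x => qpi (@S1_act G _ _) (restrict (tagged s) x)) hom_split_data).
  - exact: in_Jset_inj.
  - by move=> s; exact: hom_summand.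
  (* If all bits are false, f is unchanged by erasing every coordinate, so it is constant. *)
  - move=> b; have [|b0] := in_Jset_surj b; [by left|right=> Z f fm fe x].
    rewrite -(bgmap_pt fm) -(respects_erase_seq (s := iota 0 n) x fe).
      congr f; apply: hom_eq => i.
      by rewrite erase_seq mem_iota /= ltn_ord.
    by move=> k; rewrite mem_iota /= => kn; rewrite kn b0.
(* The single wedge over all pairs (r, m) is regrouped by rank, and the inner wedges are then moved
   inside the suspension. *)
apply: bgheq_trans.
  apply: bgheq_sym.
  exact: (@bigwedge_assoc R G 'I_n (fun r => Jset n r.+1)
    (fun r m => susp R (hom_mod_S1 G (Porders q m)))).
by apply: bigwedge_heq => r; apply: bgheq_sym; exact: susp_bigwedge.
Qed.

End hom_splitting.

(* The summand of index r : 'I_n of the outer wedge is the one of rank r.+1. *)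
Theorem theorem1p1 (R : realType) (k : nat) (c : 'I_k -> classical_group)
    (n : nat) (q : 'I_n -> int) :
  let G : topGroupType := cg_prod R c in
  exists Theta :
    susp R (hom_space G q) ->
    bigwedge (fun r : 'I_n =>
      susp R (bigwedge (fun m : Jset n r.+1 => hom_mod_S1 G (Porders q m)))),
  bg_homotopy_equivalence R Theta.
Proof.
move=> G.
(* The radius of the contraction depends on the order q_i, so one contraction is chosen for each
   coordinate. *)
have /(_ _)/cid-/all_sig[H HP] := fun i => @cg_prod_contraction R k c (q i).
have {HP} /(_ _)/cid-/all_sig[U P] := HP.
exact: (hom_splitting P).
Qed.
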